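(* Let $f:\mathbb{R}^d\to\mathbb{R}$ be differentiable with minimizer $x^*\in\arg\min_{x\in\mathbb{R}^d}f(x)$, let $x^0\in\mathbb{R}^d$, $R>0$, $R\ge\|x^0-x^*\|$, and $Q=B_{3R}(x^* )$. Suppose that for some $L>0$ and all $x,y\in Q$: $\|\nabla f(x)-\nabla f(y)\|\le L\|x-y\|$, $\|\nabla f(x)\|^2\le2L(f(x)-\inf_Qf)$, and $f(y)\ge f(x)+\langle\nabla f(x),y-x\rangle$. Let $K>0$ be an integer and $\delta\in(0,1]$. Assume that for $k=0,1,\dots,K$ the estimators $\nabla f_{\Xi^k}(x^{k+1})$ used by clipped-SSTM have bias at most $b_k\ge0$ and variance at most $\sigma_k^2$, $\sigma_k\ge0$ (in the sense given in the context), put $b=\max_{0\le k\le K}b_k$, $\sigma=\max_{0\le k\le K}\sigma_k$, and let \[ a\ge\max\left\{97200\ln^2\frac{4K}\delta,\ \frac{1800\sigma(K+1)\sqrt K\sqrt{\ln\frac{4K}\delta}}{LR},\ \frac{4b(K+2)^2}{15LR},\ \frac{60b(K+2)\ln\frac{4K}\delta}{LR}\right\},\qquad \lambda_k=\frac{R}{30\alpha_{k+1}\ln\frac{4K}\delta}. \] Then after $K$ iterations of clipped-SSTM, with probability at least $1-\delta$, \[ f(y^K)-f(x^* )\le\frac{6aLR^2}{K(K+3)}\quad\text{and}\quad\{x^k\}_{k=0}^{K+1},\{z^k\}_{k=0}^K,\{y^k\}_{k=0}^K\subseteq B_{2R}(x^* ). \] In particular, when $a$ equals the maximum above, then with probability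 at least $1-\delta$ \[ f(y^K)-f(x^* )=\mathcal{O}\left(\max\left\{\frac{LR^2\ln^2\frac K\delta}{K^2},\ \frac{\sigma R\sqrt{\ln\frac K\delta}}{\sqrt K},\ \frac{bR\ln\frac K\delta}K,\ bR\right\}\right). \]
   Context: $\|\cdot\|$ is the Euclidean norm; $B_r(x^* )$ is the ball of radius $r$ centred at $x^*$. $\mathrm{clip}(x,\lambda)=\min\{1,\lambda/\|x\|\}x$ for $x\ne0$, $\mathrm{clip}(0,\lambda)=0$. clipped-SSTM with parameter $a>0$: $z^0=y^0=x^0$, $\alpha_0=A_0=0$, $\alpha_{k+1}=\frac{k+2}{2aL}$, $A_{k+1}=A_k+\alpha_{k+1}$, and for $k\ge0$ \[ x^{k+1}=\frac{A_ky^k+\alpha_{k+1}z^k}{A_{k+1}},\quad z^{k+1}=z^k-\alpha_{k+1}\mathrm{clip}(\nabla f_{\Xi^k}(x^{k+1}),\lambda_k),\quad y^{k+1}=\frac{A_ky^k+\alpha_{k+1}z^{k+1}}{A_{k+1}}, \] where $\nabla f_{\Xi^k}(x^{k+1})$ is sampled independently of previous iterations. Bias/variance assumption with parameters $b_k,\sigma_k$: the estimator is obtained by applying an aggregation rule to some number $N$ of i.i.d. stochastic gradients from the oracle, $\nabla f_{\Xi^k}(x)=\mathcal{R}(\nabla f_{\xi_1}(x),\dots,\nabla f_{\xi_N}(x))$, and for every $x\in\mathbb{R}^d$ \[ \|\mathbb{E}[\nabla f_{\Xi^k}(x)]-\nabla f(x)\|\le b_k,\qquad\mathbb{E}\big[\|\nabla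 f_{\Xi^k}(x)-\mathbb{E}[\nabla f_{\Xi^k}(x)]\|^2\big]\le\sigma_k^2 . \] $\mathcal{O}(\cdot)$ hides a universal numerical constant, with $K/\delta$ bounded away from $1$ (e.g. $K\ge2$). *)

(* Defs.v *)
From mathcomp Require Import all_boot all_order all_algebra.
From mathcomp Require Import all_classical all_reals all_analysis.

Set Implicit Arguments.
Unset Strict Implicit.
Unset Printing Implicit Defensive.

Import Order.TTheory GRing.Theory Num.Theory.
Import numFieldNormedType.Exports.

Local Open Scope classical_set_scope.
Local Open Scope ring_scope.

(* The library norm on matrices is the sup norm, hence explicit Euclidean
   notions; the topology (so differentiability) is the same for both norms. *)
Definition dot (R : realType) (d : nat) (u v : 'rV[R]_d) : R :=
  \sum_(i < d) u 0 i * v 0 i.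

Definition enorm (R : realType) (d : nat) (u : 'rV[R]_d) : R :=
  Num.sqrt (\sum_(i < d) u 0 i ^+ 2).

Definition eball (R : realType) (d : nat) (c : 'rV[R]_d) (r : R) :
    set 'rV[R]_d :=
  [set x | enorm (x - c) <= r].

Definition grad (R : realType) (d : nat) (f : 'rV[R]_d -> R)
    (x : 'rV[R]_d) : 'rV[R]_d :=
  \row_(i < d) 'D_(delta_mx 0 i) f x.

(* Real m x n matrices (and row vectors, m = 1) with their Borel sets. *)
Notation borel R m n := (g_sigma_algebraType (@open 'M[R]_(m, n))).

Definition mutually_independent (d d' : measure_display)
    (T : measurableType d) (R : realType) (P : probability T R)
    (Z : measurableType d') (I : finType) (X : I -> {RV P >-> Z}) : Prop :=
  forall (J : {set I}) (A : I -> set Z), (forall i, measurable (A i)) ->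
    P (\bigcap_(i in [set` J]) (X i @^-1` A i)) =
    (\prod_(i in J) P (X i @^-1` A i))%E.

Definition mean_vec (d : measure_display) (T : measurableType d)
    (R : realType) (P : probability T R) (n : nat)
    (X : T -> 'rV[R]_n) : 'rV[R]_n :=
  \row_(i < n) fine 'E_P[fun w => X w 0 i].

Definition bias_var_bounded (d : measure_display) (T : measurableType d)
    (R : realType) (P : probability T R) (n : nat)
    (X : T -> 'rV[R]_n) (g : 'rV[R]_n) (b s : R) : Prop :=
  [/\ (forall i, P.-integrable setT (fun w => (X w 0 i)%:E)),
      enorm (mean_vec P X - g) <= b &
      ('E_P[fun w => (enorm (X w - mean_vec P X) ^+ 2)%R]
         <= (s ^+ 2)%:E)%E].

(* The rule receives the stochastic gradients as the rows of a matrix. *)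
Definition aggregate (R : realType) (d N : nat) (Z : Type)
    (rule : 'M[R]_(N, d) -> 'rV[R]_d) (oracle : Z -> 'rV[R]_d -> 'rV[R]_d)
    (xi : 'I_N -> Z) (x : 'rV[R]_d) : 'rV[R]_d :=
  rule (\matrix_(j < N) oracle (xi j) x).

(* At x = 0 the division by zero is harmless: the result is 0. *)
Definition clip (R : realType) (d : nat) (x : 'rV[R]_d) (lam : R) :
    'rV[R]_d :=
  Num.min 1 (lam / enorm x) *: x.

Definition sstm_alpha (R : realType) (a L : R) (k : nat) : R :=
  if k is k'.+1 then (k'.+2)%:R / (2 * a * L) else 0.

Definition sstm_A (R : realType) (a L : R) (k : nat) : R :=
  \sum_(0 <= i < k.+1) sstm_alpha a L i.

(* The state after k iterations is (x^k, y^k, z^k); [est k] is the realized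
   gradient estimator of iteration k, queried at x^(k+1). *)
Fixpoint sstm (R : realType) (d : nat) (a L : R) (lam : nat -> R)
    (est : nat -> 'rV[R]_d -> 'rV[R]_d) (x0 : 'rV[R]_d) (k : nat) :
    'rV[R]_d * 'rV[R]_d * 'rV[R]_d :=
  if k is k'.+1 then
    let: (_, y, z) := sstm a L lam est x0 k' in
    let al := sstm_alpha a L k in
    let A := sstm_A a L k' in
    let A' := sstm_A a L k in
    let x' := A'^-1 *: (A *: y + al *: z) in
    let z' := z - al *: clip (est k' x') (lam k') in
    let y' := A'^-1 *: (A *: y + al *: z') in
    (x', y', z')
  else (x0, x0, x0).

Definition sstm_x (R : realType) (d : nat) (a L : R) (lam : nat -> R)
    (est : nat -> 'rV[R]_d -> 'rV[R]_d) (x0 : 'rV[R]_d) (k : nat) :=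
  (sstm a L lam est x0 k).1.1.

Definition sstm_y (R : realType) (d : nat) (a L : R) (lam : nat -> R)
    (est : nat -> 'rV[R]_d -> 'rV[R]_d) (x0 : 'rV[R]_d) (k : nat) :=
  (sstm a L lam est x0 k).1.2.

Definition sstm_z (R : realType) (d : nat) (a L : R) (lam : nat -> R)
    (est : nat -> 'rV[R]_d -> 'rV[R]_d) (x0 : 'rV[R]_d) (k : nat) :=
  (sstm a L lam est x0 k).2.

(* Factors such as 972 * 10^2 stand for 97200: numerals are unary. *)
Definition sstm_a_min (R : realType) (K : nat) (delta L r b sigma : R) : R :=
  let l := ln (4 * K%:R / delta) in
  Num.max (972 * 10 ^+ 2 * l ^+ 2)
  (Num.max (18 * 10 ^+ 2 * sigma * (K.+1)%:R * Num.sqrt K%:R * Num.sqrt l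
              / (L * r))
  (Num.max (4 * b * (K.+2)%:R ^+ 2 / (15 * L * r))
           (60 * b * (K.+2)%:R * l / (L * r)))).

Definition sstm_lambda (R : realType) (a L : R) (K : nat) (delta r : R)
    (k : nat) : R :=
  r / (30 * sstm_alpha a L k.+1 * ln (4 * K%:R / delta)).

Definition sstm_rate (R : realType) (K : nat) (delta L r b sigma : R) : R :=
  let l := ln (K%:R / delta) in
  Num.max (L * r ^+ 2 * l ^+ 2 / K%:R ^+ 2)
  (Num.max (sigma * r * Num.sqrt l / Num.sqrt K%:R)
  (Num.max (b * r * l / K%:R) (b * r))).

(* The values of a measure on non-measurable sets are unspecified, so the
   measurability of the event is part of the claim. *)
Definition with_prob_ge (d : measure_display) (T : measurableType d)
    (R : realType) (P : probability T R) (p : R) (E : set T) : Prop :=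
  measurable E /\ (p%:E <= P E)%E.

(* Main.v *)
Require Import Defs.
From mathcomp Require Import all_boot all_order all_algebra.
From mathcomp Require Import all_classical all_reals all_analysis.
From mathcomp Require Import measurable_realfun.
From mathcomp Require Import ring lra.

Set Implicit Arguments.
Unset Strict Implicit.
Unset Printing Implicit Defensive.

Import Order.TTheory GRing.Theory Num.Theory.
Import numFieldNormedType.Exports.

Local Open Scope classical_set_scope.
Local Open Scope ring_scope.

(* Write Z_k = z^k - xs, l = ln (4K/delta), and theta_k for the error of the
   clipped estimator. The energy V_k = A_k (f(y^k) - f(xs)) + |Z_k|^2 / 2 obeys
     V_{k+1} <= V_k - al_{k+1} <theta_k, Z_k> + mu al_{k+1}^2 |theta_k|^2
   while the iterates stay in Q. With the deterministic radii
   rho_k = 1.06 R + b A_k + o(R) absorbing the bias, V_k < rho_k^2 / 2 keeps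
   the iterates in the ball of radius rho_k <= 2 R, so the gradient at x^{k+1}
   is below lambda_k / 2 and clipping makes the noise bounded. Applying
   e^u <= 1 + u + 60 u^2 for |u| <= 6 to the conditional expectation,
   exp (20 l / R^2 * (V_k - rho_k^2 / 2 + decreasing correction)) is a
   supermartingale until it reaches 1, and the maximal inequality bounds the
   probability of ever reaching 1 by delta / 4.

   This gives A_K (f(y^K) - f(xs)) <= rho_K^2 / 2, which is at most 3/2 R^2
   unless b A_K is comparable to R. In that case K and l are large, and a second
   potential, quadratic in Z_k and Y_k = (A_k / A_K) (y^k - xs) with a cross
   term, gains a strictly negative drift that pays for most of the bias; its
   exponential is added to the supermartingale.

   The conditional expectation given the past is replaced by a decoupling
   inequality for integrals over the product of the sigma-algebras generated by
   the past and the current oracle samples. *)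

(** The difficulty is that the constants leave almost no room. The lower bound on [a] only gives A_K
    b <= 15/16 R, so rho_K may be almost 2 R, and rho_K^2 / 2 is then close to 2 R^2 instead of the
    required 3/2 R^2. The energy argument is lossy there: it charges every step its bias times
    rho_k, as if |Z_k| were always maximal. In the second potential the bias is paired with v = (3 -
    t)/2 Z - Y/2, where t = A_k / A_K, and the negative drift is a quadratic form in (Z, Y) that
    dominates |v|^2 up to a weight. Young's inequality then turns a charge linear in B = A_K b / R
    into B^2 / 4 times that weight, which integrates to 2/3 B^2; at B = 15/16 the total, margins
    included, is just below 3/2. The scale 20 l / R^2 balances two demands: an initial margin of R^2
    / 20 becomes the factor exp (- l) = delta / (4 K), while the step bound al lambda = R / (30 l)
    keeps the centred exponent within 24/5, inside the range of the quadratic bound. *)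

Section InnerProduct.
Context {R : realType} {d : nat}.
Implicit Types (u v w : 'rV[R]_d) (c : R).

Lemma dotC u v : dot u v = dot v u.
Proof. by apply: eq_bigr => i _; rewrite mulrC. Qed.

Lemma dotDl u v w : dot (u + v) w = dot u w + dot v w.
Proof. by rewrite /dot -big_split; apply: eq_bigr => i _; rewrite !mxE mulrDl. Qed.

Lemma dotZl c u w : dot (c *: u) w = c * dot u w.
Proof. by rewrite /dot mulr_sumr; apply: eq_bigr => i _; rewrite !mxE mulrA. Qed.

Lemma dotNl u w : dot (- u) w = - dot u w.
Proof. by rewrite -scaleN1r dotZl mulN1r. Qed.

Lemma dotBl u v w : dot (u - v) w = dot u w - dot v w.
Proof. by rewrite dotDl dotNl. Qed.

Lemma dotDr u v w : dot u (v + w) = dot u v + dot u w.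
Proof. by rewrite dotC dotDl !(dotC u). Qed.

Lemma dotZr c u w : dot u (c *: w) = c * dot u w.
Proof. by rewrite dotC dotZl dotC. Qed.

Lemma dotNr u w : dot u (- w) = - dot u w.
Proof. by rewrite dotC dotNl dotC. Qed.

Lemma dotBr u v w : dot u (v - w) = dot u v - dot u w.
Proof. by rewrite dotDr dotNr. Qed.

Definition dotE := (dotDl, dotDr, dotNl, dotNr, dotZl, dotZr).

Lemma dotvv_ge0 u : 0 <= dot u u.
Proof. by apply: sumr_ge0 => i _; rewrite -expr2 sqr_ge0. Qed.

Lemma enorm_sqr u : enorm u ^+ 2 = dot u u.
Proof.
rewrite /enorm sqr_sqrtr; last by apply: sumr_ge0 => i _; rewrite sqr_ge0.
by apply: eq_bigr => i _; rewrite expr2.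
Qed.

Lemma enorm_ge0 u : 0 <= enorm u.
Proof. exact: sqrtr_ge0. Qed.

Lemma enorm_le u c : 0 <= c -> dot u u <= c ^+ 2 -> enorm u <= c.
Proof. by move=> c0; rewrite -enorm_sqr ler_sqr ?nnegrE ?enorm_ge0. Qed.

Lemma dot_le_sqr u c : enorm u <= c -> dot u u <= c ^+ 2.
Proof.
move=> uc; rewrite -enorm_sqr ler_sqr ?nnegrE ?enorm_ge0//.
exact: le_trans (enorm_ge0 u) uc.
Qed.

Lemma dotvv_eq0 u : dot u u = 0 -> u = 0.
Proof.
move=> /eqP; rewrite psumr_eq0; last by move=> i _; rewrite -expr2 sqr_ge0.
move=> /allP u0; apply/rowP => i; rewrite mxE; apply/eqP.
by have := u0 i (mem_index_enum i); rewrite /= mulf_eq0 orbb.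
Qed.

Lemma dot0l u : dot 0 u = 0.
Proof. by rewrite -(scale0r u) dotZl mul0r. Qed.

Lemma dot_sqr_le u v : dot u v ^+ 2 <= dot u u * dot v v.
Proof.
have [v0|vn0] := eqVneq (dot v v) 0.
  by rewrite (dotvv_eq0 v0) dotC !dot0l expr2 !mulr0.
have vgt0 : 0 < dot v v by rewrite lt_neqAle eq_sym vn0 dotvv_ge0.
have := dotvv_ge0 (dot v v *: u - dot u v *: v).
rewrite !dotE (dotC v u) => h.
rewrite -(ler_pM2r vgt0); nra.
Qed.

Lemma dot_le u v : dot u v <= enorm u * enorm v.
Proof.
have := dot_sqr_le u v; rewrite -!enorm_sqr -exprMn => h.
apply: le_trans (ler_norm _) _.
by rewrite -ler_sqr ?nnegrE ?mulr_ge0 ?enorm_ge0// real_normK ?num_real.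
Qed.

Lemma dotN_le u v : - dot u v <= enorm u * enorm v.
Proof.
have -> : enorm u = enorm (- u).
  by apply/eqP; rewrite -(@eqrXn2 _ 2)// ?enorm_ge0// !enorm_sqr !dotE opprK.
by rewrite -dotNl; exact: dot_le.
Qed.

Lemma enormD u v : enorm (u + v) <= enorm u + enorm v.
Proof.
apply: enorm_le; first by rewrite addr_ge0 ?enorm_ge0.
rewrite !dotE (dotC v u) -!enorm_sqr; have := dot_le u v; nra.
Qed.

Lemma enormZ c u : enorm (c *: u) = `|c| * enorm u.
Proof.
apply/eqP; rewrite -(@eqrXn2 _ 2)// ?mulr_ge0 ?enorm_ge0//.
by rewrite exprMn !enorm_sqr !dotE real_normK ?num_real// expr2 mulrA.
Qed.

Lemma enormN u : enorm (- u) = enorm u.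
Proof. by rewrite -scaleN1r enormZ normrN1 mul1r. Qed.

Lemma enormB u v : enorm (u - v) <= enorm u + enorm v.
Proof. by rewrite -(enormN v); exact: enormD. Qed.

Lemma enorm0 : enorm (0 : 'rV[R]_d) = 0.
Proof. by rewrite -(scale0r 0) enormZ normr0 mul0r. Qed.

(** Shaped like the updates, with p = A_k and q = al_{k+1}; p may vanish because A_0 = 0. *)
Lemma eball_convex c (xs u v : 'rV[R]_d) (p q : R) : 0 <= p -> 0 <= q ->
  0 < p + q -> enorm (u - xs) <= c -> enorm (v - xs) <= c ->
  enorm ((p + q)^-1 *: (p *: u + q *: v) - xs) <= c.
Proof.
move=> p0 q0 pq hu hv.
have -> : (p + q)^-1 *: (p *: u + q *: v) - xs =
    (p + q)^-1 *: (p *: (u - xs) + q *: (v - xs)).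
  rewrite -[X in _ - X](scalerK (lt0r_neq0 pq)) -scalerBr; congr (_ *: _).
  by rewrite !scalerBr scalerDl opprD addrACA.
rewrite enormZ gtr0_norm ?invr_gt0// ler_pdivrMl//.
apply: le_trans (enormD _ _) _.
rewrite !enormZ !ger0_norm// mulrDl.
by apply: lerD; apply: ler_wpM2l.
Qed.

End InnerProduct.

(** * One accelerated step: deterministic energy inequalities *)

Section AcceleratedStep.
Context {R : realType} {d : nat}.
Variables (f : 'rV[R]_d -> R) (xs g C y z : 'rV[R]_d) (al A a L : R).
Let x := (A + al)^-1 *: (A *: y + al *: z).
Let z' := z - al *: C.
Let y' := (A + al)^-1 *: (A *: y + al *: z').
Hypotheses (al_gt0 : 0 < al) (A_ge0 : 0 <= A) (a_ge4 : 4 <= a) (L_gt0 : 0 < L).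
Hypothesis A_big : a * L * al ^+ 2 <= A + al.
Hypothesis descent : f y' <= f x + dot g (y' - x) + L * dot (y' - x) (y' - x).
Hypothesis convex_y : f x + dot g (y - x) <= f y.
Hypothesis convex_xs : f x + dot g (xs - x) <= f xs.

Let A'_gt0 : 0 < A + al. Proof. by rewrite ltr_wpDl. Qed.

Lemma step_displacement : y' - x = - (al ^+ 2 / (A + al)) *: C.
Proof.
rewrite /y' /x -scalerBr /z' opprD addrACA subrr add0r -scalerBr.
rewrite addrAC subrr add0r scalerN !scalerA scalerN scaleNr.
by rewrite scalerA -expr2 mulrC.
Qed.

Lemma step_coupling : A *: (y - x) = al *: (x - z).
Proof.
have h : (A + al) *: x = A *: y + al *: z by rewrite scalerKV ?lt0r_neq0.
rewrite !scalerBr; apply/eqP; rewrite subr_eq addrAC eq_sym subr_eq.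
by rewrite -scalerDl addrC h.
Qed.

(** Since y' - x = - al^2 / (A + al) C, the quadratic term of [descent], multiplied by A + al, is L
    al^4 / (A + al) |C|^2, and [A_big] reduces it to al^2 / a |C|^2. *)
Lemma descent_scaled : (A + al) * f y' <=
  (A + al) * f x - al ^+ 2 * dot g C + al ^+ 2 / a * dot C C.
Proof.
have := descent; rewrite step_displacement !dotE => h.
have aC : L * (al ^+ 2 / (A + al)) <= a^-1.
  have a0 : 0 < a by exact: lt_le_trans a_ge4.
  by rewrite mulrA ler_pdivrMr// ler_pdivlMl// mulrA.
have := ler_wpM2l (ltW A'_gt0) h => /le_trans; apply.
have CC := dotvv_ge0 C.
have e : (A + al) * (al ^+ 2 / (A + al)) = al ^+ 2.
  by rewrite mulrC divfK ?lt0r_neq0.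
move: (f x) (dot g C) (dot C C) CC => Fx gC CC CC0.
move: e aC; set q := al ^+ 2 / (A + al) => e aC.
rewrite [leLHS](_ : _ = (A + al) * Fx - ((A + al) * q) * gC +
  ((A + al) * q) * (L * q * CC)); last by ring.
rewrite e lerD2l -(mulrA _ a^-1); apply: ler_wpM2l; first exact: sqr_ge0.
exact: ler_wpM2r.
Qed.

Lemma convex_y_scaled : A * f x + al * dot g (x - z) <= A * f y.
Proof.
rewrite -dotZr -step_coupling dotZr -mulrDr.
exact: ler_wpM2l.
Qed.

(** Here |C|^2 / 2 - <g, C> = |C - g|^2 / 2 - |g|^2 / 2, and |C|^2 <= 2 |C - g|^2 + 2 |g|^2 is |C -
    2 g|^2 >= 0. As 2 / a <= 1/2, the negative |g|^2 absorbs the other one. The coefficient thus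
    stays near 1/2, which the growth of the radii can pay exactly. *)
Lemma estimator_energy :
  al ^+ 2 * (2^-1 * dot C C - dot g C + a^-1 * dot C C) <=
  (2^-1 + 2 / a) * (al ^+ 2 * dot (C - g) (C - g)).
Proof.
rewrite mulrCA ler_wpM2l ?sqr_ge0// !dotE (dotC C g).
have a0 : 0 < a by exact: lt_le_trans a_ge4.
have ai : a^-1 <= 4^-1 by rewrite lef_pV2 ?posrE.
have ai0 : 0 < a^-1 by rewrite invr_gt0.
have := dotvv_ge0 (C - 2 *: g); rewrite !dotE (dotC C g) => h.
have := dotvv_ge0 g => gg.
set p := a^-1 in ai ai0 *.
have h1 := mulr_ge0 (ltW ai0) h.
have h2 : p * dot g g <= 4^-1 * dot g g by rewrite ler_wpM2r.
lra.
Qed.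

(** The convexity inequalities at y and xs, with weights A and al, contribute al <g, z - xs>; the
    square |z' - xs|^2 / 2 contributes - al <C, z - xs>. Only the error C - g survives in the linear
    term. *)
Lemma energy_step :
  (A + al) * (f y' - f xs) + 2^-1 * dot (z' - xs) (z' - xs) <=
  A * (f y - f xs) + 2^-1 * dot (z - xs) (z - xs)
  - al * dot (C - g) (z - xs) + (2^-1 + 2 / a) * (al ^+ 2 * dot (C - g) (C - g)).
Proof.
have h1 := descent_scaled; have h2 := convex_y_scaled.
have h3 : al * f x + al * dot g (xs - x) <= al * f xs.
  by rewrite -mulrDr ler_wpM2l// ltW.
have h4 := estimator_energy.
have -> : z' - xs = (z - xs) - al *: C by rewrite /z' addrAC.
move: h2 h3 h4.
have -> : dot g (x - z) = dot g (x - xs) - dot g (z - xs).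
  by rewrite -dotBr; congr dot; rewrite opprB addrA subrK.
rewrite -(opprB x xs) dotNr.
move: (z - xs) (dot g (x - xs)) => Z gX; rewrite !dotE (dotC Z C).
move: h1; rewrite (dotC C g); move: (f y') (f x) (f y) (f xs) => *; lra.
Qed.

(* At t = 1 this is phi + |Z - Y / 2|^2 / 2, so it dominates phi. *)
Definition refined_potential (t phi : R) (Z Y : 'rV[R]_d) : R :=
  (3 - t) / 2 * phi + (3 - t) / 4 * dot Z Z - 2^-1 * dot Z Y
  + (3 - 2 * t) / 8 * dot Y Y.

(** Compared with [energy_step], the cross term - <Z, Y> / 2 produces an extra al / 2 <g, Y>. Its
    two parts in [gY] shift the weights of the convexity inequalities: to (3 - t) / 2 at y, the
    weight of the old potential, and to (3 - 2 t - tau) / 2 at xs. With these weights the values of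
    f at x and at xs cancel exactly. The term multiplied by tau collects the quadratic effects of
    the changing weights and of Y growing by tau Z'. *)
Lemma refined_step (S t tau : R) : 0 < S -> A = t * S -> al = tau * S ->
  t + tau <= 1 ->
  refined_potential (t + tau) ((A + al) * (f y' - f xs)) (z' - xs)
    ((t + tau) *: (y' - xs)) <=
  refined_potential t (A * (f y - f xs)) (z - xs) (t *: (y - xs))
  - al * dot (C - g) ((3 - t - tau) / 2 *: (z - xs) - 2^-1 *: (t *: (y - xs)))
  + (3 - t - tau) / 2 * (2^-1 + 2 / a) * (al ^+ 2 * dot (C - g) (C - g))
  + tau * (- 4^-1 * dot (z - xs) (z - xs) - 2^-1 * dot (z' - xs) (z' - xs)
      + (3 - 2 * (t + tau)) / 4 * dot (t *: (y - xs)) (z' - xs)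
      - 4^-1 * dot (t *: (y - xs)) (t *: (y - xs))
      + (3 - 2 * (t + tau)) / 8 * tau * dot (z' - xs) (z' - xs)).
Proof.
move=> S_gt0 tS tauS t1.
set Z := z - xs; set Z' := z' - xs; set Y := t *: (y - xs).
have t0 : 0 <= t by have := A_ge0; rewrite tS pmulr_lge0.
have tau0 : 0 < tau by have := al_gt0; rewrite tauS pmulr_lgt0.
have S0 := lt0r_neq0 S_gt0.
have et : t = S^-1 * A by rewrite tS mulrC mulfK.
have etau : tau = S^-1 * al by rewrite tauS mulrC mulfK.
have eY : (t + tau) *: (y' - xs) = Y + tau *: Z'.
  have e : (A + al) *: y' = A *: y + al *: z' by rewrite scalerKV ?lt0r_neq0.
  rewrite /Y /Z' et etau -mulrDr -!scalerA -scalerDr; congr (_ *: _).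
  by rewrite scalerBr e scalerDl !scalerBr opprD addrACA.
have eZ : Z' = Z - al *: C by rewrite /Z' /z' addrAC.
have gY : dot g Y = tau * dot g (x - z) + t * dot g (x - xs).
  have -> : Y = t *: (y - x) + t *: (x - xs).
    by rewrite -scalerDr addrA subrK.
  rewrite dotDr !dotZr; congr (_ + _).
  have := congr1 (dot g) step_coupling; rewrite !dotZr => e.
  by rewrite et etau -!mulrA e.
have h1 : (3 - t - tau) / 2 * ((A + al) * f y' - ((A + al) * f x -
    al ^+ 2 * dot g C + al ^+ 2 / a * dot C C)) <= 0.
  rewrite mulr_ge0_le0//; first by lra.
  by rewrite subr_le0; exact: descent_scaled.
have h2 : ((3 - t) / 2) * (A * f x + al * dot g (x - z) - A * f y) <= 0.
  rewrite mulr_ge0_le0//; first by lra.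
  by rewrite subr_le0; exact: convex_y_scaled.
have h3 : ((3 - t - tau) / 2 - t / 2) * al * (f x + dot g (xs - x) - f xs) <= 0.
  rewrite mulr_ge0_le0//; first by rewrite mulr_ge0 ?(ltW al_gt0)//; lra.
  by rewrite subr_le0.
have h4 : (3 - t - tau) / 2 * (al ^+ 2 * (2^-1 * dot C C - dot g C + a^-1 * dot C C) -
    (2^-1 + 2 / a) * (al ^+ 2 * dot (C - g) (C - g))) <= 0.
  rewrite mulr_ge0_le0//; first by lra.
  by rewrite subr_le0; exact: estimator_energy.
have egxz : dot g (x - z) = dot g (x - xs) - dot g Z.
  by rewrite -dotBr; congr dot; rewrite opprB addrA subrK.
rewrite /refined_potential eY eZ; clear eY eZ; clearbody Z' Y Z.
move: h2 h3 gY; rewrite egxz -(opprB x xs) dotNr.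
move: (dot g (x - xs)) => gX h2 h3 gY.
move: h1 h2 h3 h4; rewrite !dotE (dotC Y Z) (dotC Z C) (dotC Y C) (dotC C g).
move: (f y') (f x) (f y) (f xs) (dot C C) (dot g g) (dot g C) gY => Fy' Fx Fy Fs CC gg gC gY.
rewrite gY.
move: (dot C Z) (dot C Y) (dot Z Z) (dot Z Y) (dot Y Y) (dot g Z) => CZ CY ZZ ZY YY gZ.
move=> h1 h2 h3 h4; clear -tS tauS h1 h2 h3 h4.
rewrite {}tS {}tauS in h1 h2 h3 h4 *.
lra.
Qed.

End AcceleratedStep.

(** * Deterministic properties of clipping *)

Section Clipping.
Context {R : realType} {d : nat}.
Implicit Types (x m : 'rV[R]_d) (lam : R).

Lemma enorm_eq0 x : enorm x = 0 -> x = 0.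
Proof. by move=> x0; apply: dotvv_eq0; rewrite -enorm_sqr x0 expr0n. Qed.

Lemma clip_id x lam : enorm x <= lam -> clip x lam = x.
Proof.
rewrite /clip => xl; have [x0|xn0] := eqVneq (enorm x) 0.
  by rewrite (enorm_eq0 x0) scaler0.
rewrite min_l ?scale1r// ler_pdivlMr ?mul1r//.
by rewrite lt_neqAle eq_sym xn0 enorm_ge0.
Qed.

Lemma clip_out x lam : 0 < lam -> lam < enorm x ->
  clip x lam = (lam / enorm x) *: x.
Proof.
move=> l0 lx; rewrite /clip min_r// ler_pdivrMr ?mul1r ?(ltW lx)//.
exact: lt_trans lx.
Qed.

Lemma enorm_clip x lam : 0 < lam -> enorm (clip x lam) <= lam.
Proof.
move=> l0; have [xl|lx] := leP (enorm x) lam; first by rewrite clip_id.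
have x0 := lt_trans l0 lx.
by rewrite clip_out// enormZ ger0_norm ?divfK ?lt0r_neq0// divr_ge0 ?enorm_ge0// ltW.
Qed.

(** Outside the ball the left side is |x| - lam, and u = |x - m| is at least |x| - 3/4 lam. From (u
    - lam / 2)^2 >= 0 one gets u^2 >= lam u - lam^2 / 4 >= lam (|x| - lam); this is where 3/4 comes
    from. *)
Lemma clip_bias x m lam : 0 < lam -> enorm m <= 3 / 4 * lam ->
  enorm (clip x lam - x) <= dot (x - m) (x - m) / lam.
Proof.
move=> l0 ml; have [xl|lx] := leP (enorm x) lam.
  by rewrite clip_id// subrr enorm0 divr_ge0 ?dotvv_ge0// ltW.
have x0 := lt_trans l0 lx.
rewrite clip_out// -[X in _ - X]scale1r -scalerBl enormZ.
rewrite ltr0_norm; last by rewrite subr_lt0 ltr_pdivrMr ?mul1r.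
rewrite opprB mulrBl mul1r divfK ?lt0r_neq0// ler_pdivlMr// -enorm_sqr.
have : enorm x <= enorm (x - m) + enorm m by rewrite -{1}(subrK m x) enormD.
have := enorm_ge0 (x - m); move: (enorm (x - m)) (enorm x) (enorm m) ml => u v w *.
have h : v - 3 / 4 * lam <= u by lra.
have := sqr_ge0 (u - lam / 2); nra.
Qed.

(** Clipping projects onto a ball that contains m. Outside the ball, with t = lam / |x|, the right
    side minus the left side is (1 - t) (2 (lam |x| - <x, m>) + (1 - t) |x|^2). *)
Lemma clip_contract x m lam : 0 < lam -> enorm m <= lam ->
  dot (clip x lam - m) (clip x lam - m) <= dot (x - m) (x - m).
Proof.
move=> l0 ml; have [xl|lx] := leP (enorm x) lam; first by rewrite clip_id.
have x0 := lt_trans l0 lx.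
rewrite clip_out//; set t := lam / enorm x.
have tx : t * enorm x = lam by rewrite divfK ?lt0r_neq0.
have t0 : 0 < t by rewrite divr_gt0.
have t1 : t < 1 by rewrite ltr_pdivrMr ?mul1r.
have xm : dot x m <= enorm x * lam.
  by apply: le_trans (dot_le _ _) _; rewrite ler_wpM2l ?enorm_ge0.
rewrite !dotE (dotC m x) -!enorm_sqr.
have t10 : 0 < 1 - t by lra.
have : 0 <= (1 - t) * (enorm x * lam - dot x m) by rewrite mulr_ge0; lra.
move: (enorm x) (dot x m) xm tx x0 lx => v p xm <- x0 lx h.
have : 0 <= (1 - t) * ((1 - t) * v ^+ 2) by rewrite !mulr_ge0 ?sqr_ge0//; lra.
nra.
Qed.

End Clipping.

(** * Borel measurability of matrix-valued maps, entry by entry *)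

Section BorelMatrices.
Context {R : realType} {dX : measure_display} {X : measurableType dX}.

Lemma measurable_borel_coord (m n : nat) (i : 'I_m) (j : 'I_n) :
  measurable_fun setT (fun M : borel R m n => (M : 'M[R]_(m, n)) i j).
Proof.
apply: (measurability _ (measurable_realfun.RGenOpens.measurableE R)) => _ [_ [p [q ->] <-]].
rewrite setTI; apply: sub_sigma_algebra.
have /continuousP := @coord_continuous R m n i j; apply.
exact: interval_open.
Qed.

(** Balls of the sup norm are finite intersections of conditions on entries, and every open set is a
    countable union of balls with rational centre and radius 1 / (p + 1). *)
Lemma measurable_borel_mx (m n : nat) (F : X -> 'M[R]_(m, n)) :
  (forall i j, measurable_fun setT (fun x => F x i j)) ->
  measurable_fun setT (F : X -> borel R m n).
Proof.
move=> mF.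
have m_ball (c : 'M[R]_(m, n)) e : 0 < e -> measurable (F @^-1` ball c e).
  move=> e0.
  rewrite [X in measurable X](_ : _ = \bigcap_(p in [set: 'I_m * 'I_n])
    ((fun x => F x p.1 p.2) @^-1` ball (c p.1 p.2) e)).
    apply: fin_bigcap_measurable; first exact: finite_finset.
    move=> p _; rewrite -[X in measurable X]setTI; apply: mF => //.
    by apply: open_measurable; exact: ball_open.
  apply/seteqP; split=> [x [_ h] [i j] _|x h]; first exact: h.
  by split=> // i j; exact: (h (i, j) I).
apply: (@measurability _ _ X (borel R m n) setT F (@open 'M[R]_(m, n))) => //.
move=> _ [U oU <-]; rewrite setTI.
(* The pairs (centre, p) are enumerated by their codes; codes without a meaning and balls not
   contained in U contribute the empty set. *)
pose W (k : nat) : set 'M[R]_(m, n) :=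
  if unpickle k is Some (q, p) then
    let B := ball (map_mx ratr (q : 'M[rat]_(m, n)) : 'M[R]_(m, n))
               (p.+1%:R^-1 : R) in
    if `[< B `<=` U >] then B else set0
  else set0.
rewrite [X in measurable X](_ : _ = \bigcup_k (F @^-1` W k)).
  apply: bigcupT_measurable => k; rewrite /W.
  case: (unpickle k) => [[q p]|]; last by rewrite preimage_set0.
  by case: ifP => _; [exact: m_ball | rewrite preimage_set0].
apply/seteqP; split => [x Ux|x [k _]]; last first.
  rewrite /W /=; case: (unpickle k) => [[q p]|//].
  by case: ifP => // /asboolP; apply.
have /nbhs_ballP [e /= e0 eU] := open_nbhs_nbhs (conj oU Ux).
have [p pe] : exists p : nat, (p.+1%:R^-1 : R) < e / 2.
  have e20 : 0 < e / 2 by rewrite divr_gt0.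
  by have [p] := ltr_add_invr e20; rewrite add0r; exists p.
have p0 : 0 < (p.+1%:R^-1 : R) by rewrite invr_gt0.
have q_ex i j : {q : rat | `|F x i j - ratr q| < p.+1%:R^-1}.
  apply: cid.
  have : F x i j - p.+1%:R^-1 < F x i j + p.+1%:R^-1 by rewrite ltrD2l gtrN.
  move=> /rat_in_itvoo[q]; rewrite in_itv/= => hq.
  by exists q; rewrite ltr_distlC.
pose q : 'M[rat]_(m, n) := \matrix_(i, j) sval (q_ex i j).
have qF : ball (map_mx ratr q : 'M[R]_(m, n)) p.+1%:R^-1 (F x).
  split=> // i j; rewrite !mxE /ball/= distrC; exact: (svalP (q_ex i j)).
exists (pickle (q, p)) => //; rewrite /W /= pickleK.
rewrite ifT//; apply/asboolP => M [_ hM]; apply: eU; split => // i j.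
have /= := hM i j; have [_ /(_ i j)] /= := qF.
rewrite /ball/= => h1 h2; rewrite -(subrK (map_mx ratr q i j) (F x i j)) -addrA.
apply: le_lt_trans (ler_normD _ _) _; rewrite distrC.
by rewrite [e]splitr; apply: ltrD; apply: lt_trans pe.
Qed.

End BorelMatrices.

(** * From independence of events to iterated integrals *)

Section Independence.
Context {d : measure_display} {T : measurableType d} {R : realType}.
Variable P : probability T R.

Lemma measurable_generated_id (G : set (set T)) : G `<=` measurable ->
  measurable_fun setT (id : T -> g_sigma_algebraType G).
Proof.
move=> Gm _ A mA; rewrite setTI.
apply: (mA (@measurable _ T)); split => //; exact: sigma_algebra_measurable.
Qed.

(** Both sides are finite measures in A on the sigma-algebra generated by the pi-system G, obtained
    by pushing P restricted to E, and P scaled by P E, along the identity of T. They agree on G,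
    hence everywhere. *)
Lemma independent_generated (G : set (set T)) (E : set T) :
  G `<=` measurable -> setI_closed G -> G setT -> measurable E ->
  (forall A, G A -> P (A `&` E) = (P A * P E)%E) ->
  forall A, <<s G >> A -> P (A `&` E) = (P A * P E)%E.
Proof.
move=> Gm GI GT mE PG A GA.
have mid := measurable_generated_id Gm.
have PE0 : 0 <= fine (P E) by rewrite fine_ge0.
have PEE : (fine (P E))%:E = P E by rewrite fineK// fin_num_measure.
pose idG : {mfun T >-> g_sigma_algebraType G} := mfun_Sub (mem_set mid).
have [m1 m1E] : exists m : {measure set (g_sigma_algebraType G) -> \bar R},
    forall B, m B = P (B `&` E).
  by unshelve eexists (pushforward (mrestr P mE) idG : {measure set _ -> \bar R}).
pose m2 : {measure set (g_sigma_algebraType G) -> \bar R} :=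
  mscale (NngNum PE0) (distribution P idG).
rewrite -m1E.
have -> : (P A * P E)%E = m2 A.
  by rewrite /m2 /= /mscale/= PEE muleC.
apply: (@measure_unique _ _ (g_sigma_algebraType G) G (fun=> setT) _ _ _ _ m1 m2) => //.
- by rewrite bigcup_const//; exists 0%N.
- by move=> B GB; rewrite m1E /m2 /= /mscale/= PEE muleC; exact: PG.
- by move=> _; rewrite m1E setTI ltey_eq fin_num_measure.
Qed.

(** The law of (X1, X2) is the product of the marginals, so by Tonelli the left side is the mean
    over w of the inner integral, which g bounds pointwise. *)
Lemma decoupling_le (d1 d2 : measure_display) (T1 : measurableType d1)
    (T2 : measurableType d2) (X1 : {mfun T >-> T1}) (X2 : {mfun T >-> T2})
    (h : T1 * T2 -> \bar R) (g : T -> \bar R) :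
  (forall A B, measurable A -> measurable B ->
    P (X1 @^-1` A `&` X2 @^-1` B) = (P (X1 @^-1` A) * P (X2 @^-1` B))%E) ->
  measurable_fun setT h -> (forall x, 0 <= h x)%E -> measurable_fun setT g ->
  (forall w, \int[P]_w' h (X1 w, X2 w') <= g w)%E ->
  (\int[P]_w h (X1 w, X2 w) <= \int[P]_w g w)%E.
Proof.
move=> indep mh h0 mg hg.
have mX : measurable_fun setT (fun w => (X1 w, X2 w)).
  by apply: measurable_fun_pair; exact: measurable_funPT.
pose X : {mfun T >-> (T1 * T2)%type} := mfun_Sub (mem_set mX).
have -> : (\int[P]_w h (X1 w, X2 w) = \int[distribution P X]_p h p)%E.
  by rewrite ge0_integral_distribution.
rewrite -(@eq_measure_integral _ _ _ _ _ (distribution P X1 \x distribution P X2)%E); last first.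
  by move=> A mA _; exact: product_measure_unique.
have mF := measurable_fun_fubini_tonelli_F (m2 := distribution P X2) h mh h0.
have F0 x : (0 <= fubini_F (distribution P X2) h x)%E by exact: integral_ge0.
rewrite fubini_tonelli1// ge0_integral_distribution//.
apply: ge0_le_integral => //.
- by move=> w _; exact: F0.
- exact: (measurableT_comp mF (measurable_funPT X1)).
move=> w _ /=; apply: le_trans (hg w).
rewrite /fubini_F ge0_integral_distribution//.
by apply: measurableT_comp => //; exact: pair1_measurable.
Qed.

End Independence.

(** * Sigma-algebras generated by disjoint subfamilies *)

Section IndependentFamily.
Context {d d' : measure_display} {T : measurableType d} {Z : measurableType d'}.
Context {R : realType} {P : probability T R} {I : finType}.
Variable X : I -> {RV P >-> Z}.
Hypothesis indX : mutually_independent X.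

Definition cylinder (J : {set I}) : set (set T) :=
  [set E | exists2 A : I -> set Z, (forall i, measurable (A i)) &
     E = \bigcap_(i in [set` J]) (X i @^-1` A i)].

Lemma cylinder_measurable J : cylinder J `<=` measurable.
Proof.
move=> _ [A mA ->]; apply: fin_bigcap_measurable; first exact: finite_finset.
by move=> i _; rewrite -[X in measurable X]setTI; exact: measurable_funP.
Qed.

Lemma cylinder_setI J : setI_closed (cylinder J).
Proof.
move=> _ _ [A mA ->] [B mB ->]; exists (fun i => A i `&` B i).
  by move=> i; exact: measurableI.
by rewrite -bigcapI.
Qed.

Lemma cylinder_setT J : cylinder J setT.
Proof.
exists (fun=> setT) => //; apply/seteqP; split => // w _ i _ //.
Qed.

Lemma cylinder_coord (J : {set I}) i : i \in J ->
  measurable_fun setT (X i : g_sigma_algebraType (cylinder J) -> Z).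
Proof.
move=> iJ _ A mA; rewrite setTI; apply: sub_sigma_algebra.
exists (fun j => if j == i then A else setT).
  by move=> j; case: eqP.
apply/seteqP; split => [w Aw j _|w /(_ i iJ)]; rewrite /preimage/=.
  by case: eqP => // ->.
by rewrite eqxx.
Qed.

Lemma cylinder_prod (J1 J2 : {set I}) E1 E2 : [disjoint J1 & J2]%B ->
  cylinder J1 E1 -> cylinder J2 E2 -> P (E1 `&` E2) = (P E1 * P E2)%E.
Proof.
move=> dJ [A mA ->] [B mB ->].
pose C i := if i \in J1 then A i else B i.
have mC i : measurable (C i) by rewrite /C; case: ifP.
have eA : \bigcap_(i in [set` J1]) (X i @^-1` A i) =
    \bigcap_(i in [set` J1]) (X i @^-1` C i).
  by apply: eq_bigcapr => i /= iJ; rewrite /C iJ.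
have eB : \bigcap_(i in [set` J2]) (X i @^-1` B i) =
    \bigcap_(i in [set` J2]) (X i @^-1` C i).
  apply: eq_bigcapr => i /= iJ; rewrite /C ifF//.
  by apply: contraTF iJ => iJ1; rewrite (disjointFr dJ).
have eU : [set` J1] `|` [set` J2] = [set` (J1 :|: J2)%SET].
  by apply/seteqP; split => i /=; rewrite finset.in_setU => /orP.
rewrite eA eB -bigcap_setU eU !indX//.
by rewrite -bigU//; apply: eq_bigl => i; rewrite finset.in_setU !inE.
Qed.

(** The pi-system argument extends one side at a time: from J1-cylinders with E2 fixed, where each
    case needs the extension from J2-cylinders with a J1-cylinder fixed. *)
Lemma independent_cylinders (J1 J2 : {set I}) E1 E2 : [disjoint J1 & J2]%B ->
  <<s cylinder J1 >> E1 -> <<s cylinder J2 >> E2 ->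
  P (E1 `&` E2) = (P E1 * P E2)%E.
Proof.
move=> dJ h1 h2.
have mE2 : measurable E2.
  have := measurable_generated_id (@cylinder_measurable J2) => /(_ measurableT E2 h2).
  by rewrite setTI.
apply: (independent_generated (@cylinder_measurable J1) (@cylinder_setI J1)
  (cylinder_setT J1) mE2) h1 => A cA.
have mA := cylinder_measurable cA.
rewrite setIC muleC.
apply: (independent_generated (@cylinder_measurable J2) (@cylinder_setI J2)
  (cylinder_setT J2) mA) h2 => B cB.
by rewrite setIC muleC; exact: (cylinder_prod dJ cA cB).
Qed.

(** The two variables are the identity of T with values in T equipped with two coarser
    sigma-algebras. A quantity of the run can then be written as h (w, w'), reading the past from w
    and the current samples from w', and is recovered on the diagonal. *)
Lemma cylinder_decoupling_le (J1 J2 : {set I})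
    (h : g_sigma_algebraType (cylinder J1) * g_sigma_algebraType (cylinder J2) ->
       \bar R) (g : T -> \bar R) : [disjoint J1 & J2]%B ->
  measurable_fun setT h -> (forall x, 0 <= h x)%E -> measurable_fun setT g ->
  (forall w, \int[P]_w' h (w, w') <= g w)%E ->
  (\int[P]_w h (w, w) <= \int[P]_w g w)%E.
Proof.
move=> dJ mh h0 mg hg.
have m1 := measurable_generated_id (@cylinder_measurable J1).
have m2 := measurable_generated_id (@cylinder_measurable J2).
apply: (@decoupling_le _ _ _ P _ _ _ _ (mfun_Sub (mem_set m1)) (mfun_Sub (mem_set m2))) => //.
by move=> A B mA mB; exact: (independent_cylinders dJ mA mB).
Qed.

End IndependentFamily.

(** * Bias and variance of a clipped estimator *)

Section Moments.
Context {dT : measure_display} {T : measurableType dT} {R : realType}.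
Variable P : probability T R.
Implicit Types f g : T -> R.

Definition summable_rv f : Prop := P.-integrable setT (EFin \o f).

Lemma summable_rvD f g : summable_rv f -> summable_rv g ->
  summable_rv (fun w => f w + g w).
Proof. by move=> hf hg; have := integrableD measurableT hf hg. Qed.

Lemma summable_rvZ c f : summable_rv f -> summable_rv (fun w => c * f w).
Proof. by move=> hf; have := integrableZl measurableT c hf. Qed.

Lemma summable_cst c : summable_rv (fun=> c).
Proof. exact: finite_measure_integrable_cst. Qed.

Lemma summable_rvB f g : summable_rv f -> summable_rv g ->
  summable_rv (fun w => f w - g w).
Proof. by move=> hf hg; have := integrableB measurableT hf hg. Qed.

Lemma summable_measurable f : summable_rv f -> measurable_fun setT f.
Proof. by move=> /integrableP[/measurable_EFinP]. Qed.

Lemma summable_le f g : measurable_fun setT f -> (forall w, `|f w| <= g w) ->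
  summable_rv g -> summable_rv f.
Proof.
move=> mf fg ig; apply: (le_integrable _ _ _ ig) => //.
  exact/measurable_EFinP.
by move=> w _ /=; rewrite lee_fin (le_trans (fg w))// ler_norm.
Qed.

Lemma summable_bounded f M : measurable_fun setT f -> (forall w, `|f w| <= M) ->
  summable_rv f.
Proof. by move=> mf fM; apply: (summable_le mf fM); exact: summable_cst. Qed.

Lemma mean_cst c : \int[P]_(w in setT) c = c.
Proof. by rewrite Rintegral_cst//= [X in fine X]probability_setT mulr1. Qed.

Lemma mean_sum (I : Type) (s : seq I) (F : I -> T -> R) :
  (forall i, summable_rv (F i)) ->
  summable_rv (fun w => \sum_(i <- s) F i w) /\
  \int[P]_(w in setT) (\sum_(i <- s) F i w) = \sum_(i <- s) \int[P]_(w in setT) F i w.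
Proof.
move=> iF; elim: s => [|i s [ih1 ih2]].
  have -> : (fun w => \sum_(j <- [::]) F j w) = (fun=> 0 : R).
    by apply/funext => w; rewrite big_nil.
  by rewrite big_nil; split; [exact: summable_cst | exact: mean_cst].
have e : (fun w => \sum_(j <- i :: s) F j w) = (fun w => F i w + \sum_(j <- s) F j w).
  by apply/funext => w; rewrite big_cons.
rewrite e big_cons; split; first exact: summable_rvD (iF i) ih1.
by rewrite (RintegralD measurableT (iF i) ih1) ih2.
Qed.

Lemma mean_dot n (F : T -> 'rV[R]_n) v :
  (forall i, summable_rv (fun w => F w 0 i)) ->
  summable_rv (fun w => dot v (F w)) /\
  \int[P]_(w in setT) dot v (F w) = dot v (mean_vec P F).
Proof.
move=> iF.
have [h1 h2] := @mean_sum _ (index_enum 'I_n) (fun i w => v 0 i * F w 0 i)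
  (fun i => summable_rvZ _ (iF i)).
split; first exact: h1.
rewrite /dot h2; apply: eq_bigr => i _.
by rewrite (RintegralZl _ measurableT (iF i)) mxE unlock.
Qed.

Lemma measurable_dot dX (X : measurableType dX) n (F G : X -> 'rV[R]_n) :
  (forall i, measurable_fun setT (fun x => F x 0 i)) ->
  (forall i, measurable_fun setT (fun x => G x 0 i)) ->
  measurable_fun setT (fun x => dot (F x) (G x)).
Proof. by move=> mF mG; apply: measurable_sum => i; exact: measurable_funM. Qed.

Lemma measurable_coordB dX (X : measurableType dX) n (F : X -> 'rV[R]_n) v i :
  measurable_fun setT (fun x => F x 0 i) ->
  measurable_fun setT (fun x => (F x - v) 0 i).
Proof.
move=> mF; have -> : (fun x => (F x - v) 0 i) = (fun x => F x 0 i - v 0 i).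
  by apply/funext => x; rewrite !mxE.
exact: measurable_funB.
Qed.

Lemma measurable_enorm dX (X : measurableType dX) n (F : X -> 'rV[R]_n) :
  (forall i, measurable_fun setT (fun x => F x 0 i)) ->
  measurable_fun setT (fun x => enorm (F x)).
Proof.
move=> mF; have msqrt : measurable_fun setT (@Num.sqrt R).
  by apply: continuous_measurable_fun; exact: sqrt_continuous.
apply: (measurableT_comp msqrt).
by apply: measurable_sum => i; exact: measurable_funX.
Qed.

Lemma measurable_clip dX (X : measurableType dX) n (F : X -> 'rV[R]_n) lam i :
  (forall j, measurable_fun setT (fun x => F x 0 j)) ->
  measurable_fun setT (fun x => clip (F x) lam 0 i).
Proof.
move=> mF.
have e : (fun x => clip (F x) lam 0 i) =
    (fun x => Num.min 1 (lam * (enorm (F x)) `^ (-1)) * F x 0 i).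
  by apply/funext => x; rewrite mxE powR_inv1// enorm_ge0.
rewrite e; apply: measurable_funM => //; apply: measurable_minr => //.
apply: measurable_funM => //.
exact: (measurableT_comp (measurable_powR (-1)) (measurable_enorm mF)).
Qed.

Section ClippedEstimator.
Variables (n : nat) (X : T -> 'rV[R]_n) (g : 'rV[R]_n) (b s lam : R).
Hypothesis X_bv : bias_var_bounded P X g b s.
Hypothesis lam_gt0 : 0 < lam.
Hypothesis mean_small : enorm (mean_vec P X) <= 3 / 4 * lam.
Let m := mean_vec P X.
Let C w := clip (X w) lam.
Let Cbar := mean_vec P C.

Let iX i : summable_rv (fun w => X w 0 i).
Proof. by have [h _ _] := X_bv; exact: h. Qed.

Let mX i : measurable_fun setT (fun w => X w 0 i).
Proof. exact: summable_measurable. Qed.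

Let mC i : measurable_fun setT (fun w => C w 0 i).
Proof. exact: measurable_clip. Qed.

Lemma coord_le_enorm k (v : 'rV[R]_k) i : `|v 0 i| <= enorm v.
Proof.
rewrite -ler_sqr ?nnegrE ?enorm_ge0// real_normK ?num_real// enorm_sqr.
rewrite /dot (bigD1 i)//= -expr2 lerDl.
by apply: sumr_ge0 => j _; rewrite -expr2 sqr_ge0.
Qed.

Let iC i : summable_rv (fun w => C w 0 i).
Proof.
apply: (@summable_bounded _ lam) => // w.
by apply: le_trans (coord_le_enorm _ _) _; exact: enorm_clip.
Qed.

(** The variance hypothesis concerns an extended real expectation; its finiteness is what yields the
    integrability used for linearity below. *)
Lemma estimator_variance : summable_rv (fun w => dot (X w - m) (X w - m)) /\
  \int[P]_(w in setT) dot (X w - m) (X w - m) <= s ^+ 2.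
Proof.
have [_ _] := X_bv; rewrite unlock -/m => h.
have h2 : (\int[P]_w (dot (X w - m) (X w - m))%:E <= (s ^+ 2)%:E)%E.
  by apply: le_trans h; under [leRHS]eq_integral do rewrite enorm_sqr.
have h0 : (0 <= \int[P]_w (dot (X w - m) (X w - m))%:E)%E.
  by apply: integral_ge0 => w _; rewrite lee_fin dotvv_ge0.
have hfin : (\int[P]_w (dot (X w - m) (X w - m))%:E)%E \is a fin_num.
  by rewrite ge0_fin_numE//; apply: le_lt_trans h2 _; rewrite ltry.
split; last by rewrite -lee_fin fineK.
apply/integrableP; split.
  by apply/measurable_EFinP; apply: measurable_dot => i; exact: measurable_coordB.
under eq_integral do rewrite /= ger0_norm ?dotvv_ge0//.
by apply: le_lt_trans h2 _; rewrite ltry.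
Qed.

(** The vector D = Cbar - m is tested against itself: |D|^2 is the mean of <D, C - X>, at most |D|
    times the mean of |C - X|, and [clip_bias] bounds the latter by the variance. Dividing by |D|
    stands in for a vector form of Jensen's inequality. *)
Lemma clip_mean_bias : enorm (Cbar - m) <= s ^+ 2 / lam.
Proof.
have [iV EV] := estimator_variance.
set D := Cbar - m.
have [i1 e1] := mean_dot D iC.
have [i2 e2] := mean_dot D iX.
have h : dot D D <= enorm D * (s ^+ 2 / lam).
  rewrite {2}/D dotBr -e1 -e2 -(RintegralB measurableT i1 i2).
  apply: (@le_trans _ _ (\int[P]_(w in setT)
      (enorm D / lam * dot (X w - m) (X w - m)))).
    apply: (le_Rintegral measurableT (summable_rvB i1 i2) (summable_rvZ _ iV)).
    move=> w _; rewrite -dotBr; apply: le_trans (dot_le _ _) _.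
    rewrite -mulrA ler_wpM2l ?enorm_ge0// mulrC.
    exact: clip_bias.
  rewrite (RintegralZl _ measurableT iV) mulrAC -mulrA ler_wpM2l ?enorm_ge0//.
  by rewrite ler_wpM2r ?invr_ge0 ?(ltW lam_gt0).
have := h; rewrite -enorm_sqr expr2.
have [->|D0] := eqVneq (enorm D) 0.
  by move=> _; rewrite divr_ge0 ?sqr_ge0// ltW.
by rewrite ler_pM2l// lt_neqAle eq_sym D0 enorm_ge0.
Qed.

Lemma clip_variance : summable_rv (fun w => dot (C w - Cbar) (C w - Cbar)) /\
  \int[P]_(w in setT) dot (C w - Cbar) (C w - Cbar) <= s ^+ 2.
Proof.
have [iV EV] := estimator_variance.
have [i1 e1] := mean_dot (2 *: (Cbar - m)) iC.
have iCC : summable_rv (fun w => dot (C w - Cbar) (C w - Cbar)).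
  apply: (@summable_bounded _ ((lam + enorm Cbar) ^+ 2)).
    by apply: measurable_dot => i; exact: measurable_coordB.
  move=> w; rewrite ger0_norm ?dotvv_ge0//; apply: dot_le_sqr.
  by apply: le_trans (enormB _ _) _; rewrite lerD2r enorm_clip.
split => //; apply: le_trans EV.
(* The added term 2 <Cbar - m, C - Cbar> has mean zero and turns the integrand into |C - m|^2 -
   |Cbar - m|^2, to which [clip_contract] applies pointwise. *)
have -> : \int[P]_(w in setT) dot (C w - Cbar) (C w - Cbar) =
   \int[P]_(w in setT) (dot (C w - Cbar) (C w - Cbar) +
     (dot (2 *: (Cbar - m)) (C w) - dot (2 *: (Cbar - m)) Cbar)).
  rewrite (RintegralD measurableT iCC (summable_rvB i1 (summable_cst _))).
  rewrite (RintegralB measurableT i1 (summable_cst _)).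
  by rewrite e1 mean_cst subrr addr0.
have iS := summable_rvD iCC (summable_rvB i1 (summable_cst (dot (2 *: (Cbar - m)) Cbar))).
apply: (le_Rintegral measurableT iS iV) => w _; apply: le_trans (clip_contract (X w) lam_gt0 (m := m) _); last first.
  by apply: le_trans mean_small _; have := lam_gt0; lra.
rewrite -/(C w); have := dotvv_ge0 (Cbar - m).
move: (C w) Cbar m => c cb mu.
by rewrite !dotE !(dotC cb c) !(dotC mu c) !(dotC mu cb) => h; lra.
Qed.

Lemma quadratic_bound_mean (h : T -> R) (V : 'rV[R]_n) (kap : R) : 0 <= kap ->
  measurable_fun setT h -> (forall w, 0 <= h w) ->
  (forall w, h w <= 1 + dot V (C w - Cbar) + kap * dot (C w - Cbar) (C w - Cbar)) ->
  (\int[P]_w (h w)%:E <= (1 + kap * s ^+ 2)%:E)%E.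
Proof.
move=> kap0 mh h0 hle.
have [iCC ECC] := clip_variance.
have [i1 e1] := mean_dot V iC.
pose q w := 1 + (dot V (C w) - dot V Cbar) + kap * dot (C w - Cbar) (C w - Cbar).
have iq1 := summable_rvB i1 (summable_cst (dot V Cbar)).
have iq2 := summable_rvD (summable_cst 1) iq1.
have iq3 := summable_rvZ kap iCC.
have iq : summable_rv q := summable_rvD iq2 iq3.
have hq w : h w <= q w by rewrite /q -dotBr.
have ih : summable_rv h.
  by apply: (summable_le mh _ iq) => w; rewrite ger0_norm.
have fh : (\int[P]_w (h w)%:E)%E \is a fin_num by exact: integrable_fin_num ih.
rewrite -(fineK fh) lee_fin.
apply: le_trans (le_Rintegral measurableT ih iq (fun w _ => hq w)) _.
rewrite (RintegralD measurableT iq2 iq3) (RintegralD measurableT (summable_cst 1) iq1).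
rewrite (RintegralB measurableT i1 (summable_cst _)) (RintegralZl _ measurableT iCC).
rewrite e1 !mean_cst subrr addr0 lerD2l.
exact: ler_wpM2l.
Qed.

End ClippedEstimator.

End Moments.

(** * Quadratic upper bounds for the exponential *)

Section QuadraticExponential.
Context {R : realType}.
Implicit Types x h c : R.

(** Because (1 - x) e^x <= 1, it suffices that (1 - x) (1 + x + 8/5 x^2) = 1 + x^2 (3/5 - 8/5 x) is
    at least 1, which is the condition x <= 3/8. *)
Lemma expR_quad_base x : x <= 3 / 8 -> expR x <= 1 + x + 8 / 5 * x ^+ 2.
Proof.
move=> xs; have h1 := expR_ge1Dx (- x).
have h2 : expR x * (1 - x) <= 1.
  by apply: le_trans (ler_wpM2l (expR_ge0 x) h1) _; rewrite expRxMexpNx_1.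
have x1 : 0 < 1 - x by lra.
rewrite -(ler_pM2r x1); apply: le_trans h2 _.
have : 0 <= x ^+ 2 * (3 / 5 - 8 / 5 * x).
  by rewrite mulr_ge0 ?sqr_ge0//; lra.
nra.
Qed.

(** Squares the bound at y = x / 2. The cubic and quartic terms are bounded by |y| <= h times y^2,
    and x^2 = 4 y^2 explains the division by 4. *)
Lemma expR_quad_double h c c' : 0 <= h -> 0 <= c ->
  (1 + 2 * c + 2 * c * h + c ^+ 2 * h ^+ 2) / 4 <= c' ->
  (forall x, `|x| <= h -> expR x <= 1 + x + c * x ^+ 2) ->
  forall x, `|x| <= 2 * h -> expR x <= 1 + x + c' * x ^+ 2.
Proof.
move=> h0 c0 cc' H x xh.
have [y xy] : exists y, x = 2 * y by exists (x / 2); lra.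
have yh : `|y| <= h by move: xh; rewrite xy normrM ger0_norm// ler_pM2l.
rewrite xy mulr_natl mulr2n expRD -expr2.
have h1 : expR y ^+ 2 <= (1 + y + c * y ^+ 2) ^+ 2.
  by rewrite ler_sqr ?nnegrE ?expR_ge0 ?H// (le_trans (expR_ge0 y))// H.
apply: le_trans h1 _.
have [yl yu] : - h <= y /\ y <= h by apply/andP; rewrite -ler_norml.
have q0 := sqr_ge0 y.
have qh : y ^+ 2 <= h ^+ 2 by rewrite -real_normK ?num_real// ler_sqr ?nnegrE.
have t3 : 2 * c * y ^+ 2 * y <= 2 * c * y ^+ 2 * h.
  by apply: ler_wpM2l => //; apply: mulr_ge0 => //; exact: mulr_ge0.
have t4 : c ^+ 2 * y ^+ 2 * y ^+ 2 <= c ^+ 2 * y ^+ 2 * h ^+ 2.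
  by apply: ler_wpM2l => //; apply: mulr_ge0 => //; exact: sqr_ge0.
have t5 : (1 + 2 * c + 2 * c * h + c ^+ 2 * h ^+ 2) / 4 * (4 * y ^+ 2) <= c' * (4 * y ^+ 2).
  by apply: ler_wpM2r => //; exact: mulr_ge0.
lra.
Qed.

(** Four doublings lead from 3/8 to 6; the intermediate constants round the recursion of
    [expR_quad_double] upwards. *)
Lemma expR_quad x : `|x| <= 6 -> expR x <= 1 + x + 60 * x ^+ 2.
Proof.
have H0 : forall x, `|x| <= 3 / 8 -> expR x <= 1 + x + 8 / 5 * x ^+ 2.
  by move=> y /ler_normlW; exact: expR_quad_base.
have H1 := @expR_quad_double (3 / 8) (8 / 5) (36 / 25) ltac:(lra) ltac:(lra) ltac:(lra) H0.
have H2 := @expR_quad_double (2 * (3 / 8)) (36 / 25) (181 / 100) ltac:(lra) ltac:(lra) ltac:(lra) H1.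
have H3 := @expR_quad_double (2 * (2 * (3 / 8))) (181 / 100) (22 / 5) ltac:(lra) ltac:(lra) ltac:(lra) H2.
have H4 := @expR_quad_double (2 * (2 * (2 * (3 / 8)))) (22 / 5) 60 ltac:(lra) ltac:(lra) ltac:(lra) H3.
by move=> x6; apply: H4; lra.
Qed.

End QuadraticExponential.

(** * Exponential moment of the clipped noise *)

Section ClippedNoise.
Context {dT : measure_display} {T : measurableType dT} {R : realType}.
Variables (P : probability T R) (n : nat) (X : T -> 'rV[R]_n) (g : 'rV[R]_n).
Variables (b sig lam al mu r l : R) (U : 'rV[R]_n).
Hypothesis X_bv : bias_var_bounded P X g b sig.
Hypotheses (lam_gt0 : 0 < lam) (al_gt0 : 0 < al) (r_gt0 : 0 < r) (l_ge1 : 1 <= l).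
Hypothesis al_lam : al * lam = r / (30 * l).
Hypotheses (g_small : enorm g <= lam / 2) (b_small : b <= lam / 4).
Hypotheses (mu_ge0 : 0 <= mu) (mu_le1 : mu <= 1).
Hypothesis U_small : enorm U <= 3 * r.
Let beta := b + sig ^+ 2 / lam.
Hypothesis beta_small : al * beta <= r / 4.
Let s := 20 * l / r ^+ 2.
Let C w := clip (X w) lam.
Let Cbar := mean_vec P C.

Let mean_small : enorm (mean_vec P X) <= 3 / 4 * lam.
Proof.
have [_ hb _] := X_bv.
have -> : mean_vec P X = (mean_vec P X - g) + g by rewrite subrK.
by apply: le_trans (enormD _ _) _; have := b_small; have := g_small; lra.
Qed.

Lemma clipped_bias : enorm (Cbar - g) <= beta.
Proof.
have [_ hb _] := X_bv.
have -> : Cbar - g = (mean_vec P X - g) + (Cbar - mean_vec P X).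
  by rewrite [RHS]addrC addrA subrK.
apply: le_trans (enormD _ _) _; apply: lerD => //.
exact: (clip_mean_bias X_bv lam_gt0 mean_small).
Qed.

Let mX i : measurable_fun setT (fun w => X w 0 i).
Proof. by have [h _ _] := X_bv; apply: (@summable_measurable _ _ _ P); exact: h. Qed.

Let mC i : measurable_fun setT (fun w => C w 0 i).
Proof. exact: measurable_clip. Qed.

Lemma clip_mean_norm : enorm Cbar <= lam.
Proof.
have iC i : summable_rv P (fun w => C w 0 i).
  apply: (@summable_bounded _ _ _ _ _ lam) => // w.
  by apply: le_trans (coord_le_enorm _ _) _; exact: enorm_clip.
have [i1 e1] := mean_dot Cbar iC.
have h : dot Cbar Cbar <= enorm Cbar * lam.
  rewrite -[leLHS]e1 -[leRHS](mean_cst P).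
  apply: (le_Rintegral measurableT i1 (summable_cst P _)) => w _.
  by apply: le_trans (dot_le _ _) _; rewrite ler_wpM2l ?enorm_ge0 ?enorm_clip.
move: h; rewrite -enorm_sqr expr2.
have [->|D0] := eqVneq (enorm Cbar) 0; first by move=> _; exact: ltW.
by rewrite ler_pM2l// lt_neqAle eq_sym D0 enorm_ge0.
Qed.

(** The error C - g is split into the centred noise D and the bias B. The direction V absorbs the
    cross term 2 mu al^2 <D, B> of the square, so the exponent is a constant [c0] plus s xi, where
    the linear part of xi has mean zero and |s xi| <= 24/5. *)
Lemma clipped_noise_mgf :
  (\int[P]_w (expR (s * (- al * dot (C w - g) U
       + mu * (al ^+ 2 * dot (C w - g) (C w - g)))))%:E <=
   (expR (s * (al * beta * enorm U + mu * (al * beta) ^+ 2)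
       + 313 * 10 ^+ 3 * l ^+ 2 * (al ^+ 2 * sig ^+ 2) / r ^+ 2))%:E)%E.
Proof.
have l0 : 0 < l by exact: lt_le_trans l_ge1.
set B := Cbar - g.
have Bb : enorm B <= beta by exact: clipped_bias.
have B0 := enorm_ge0 B; have beta0 : 0 <= beta by exact: le_trans Bb.
pose V := U - (2 * mu * al) *: B.
have V_small : enorm V <= 7 / 2 * r.
  apply: le_trans (enormB _ _) _; rewrite enormZ ger0_norm; last first.
    by rewrite !mulr_ge0// ltW.
  have : al * enorm B <= r / 4 by apply: le_trans beta_small; rewrite ler_wpM2l// ltW.
  have := U_small; have : 0 <= al * enorm B by rewrite mulr_ge0// ltW.
  by have := mu_le1; have := mu_ge0; nra.
pose D w := C w - Cbar.
have D_small w : al * enorm (D w) <= r / (15 * l).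
  have -> : r / (15 * l) = al * (2 * lam).
    by rewrite mulrCA al_lam; field; rewrite lt0r_neq0.
  rewrite ler_wpM2l ?(ltW al_gt0)//; apply: le_trans (enormB _ _) _.
  have := clip_mean_norm; have := enorm_clip (X w) lam_gt0.
  by rewrite -/(C w) -/Cbar; lra.
pose c0 := s * (- al * dot B U + mu * (al ^+ 2 * dot B B)).
pose xi w := - al * dot (D w) V + mu * (al ^+ 2 * dot (D w) (D w)).
have s0 : 0 <= s by rewrite /s; apply: divr_ge0; [have := l_ge1; lra | exact: sqr_ge0].
have split_exp w : s * (- al * dot (C w - g) U
       + mu * (al ^+ 2 * dot (C w - g) (C w - g))) = c0 + s * xi w.
  have -> : C w - g = D w + B by rewrite /D /B addrA subrK.
  have gen (u v : 'rV[R]_n) : s * (- al * dot (u + v) U +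
        mu * (al ^+ 2 * dot (u + v) (u + v))) =
      s * (- al * dot v U + mu * (al ^+ 2 * dot v v)) +
      s * (- al * dot u (U - (2 * mu * al) *: v) + mu * (al ^+ 2 * dot u u)).
    by rewrite !dotE (dotC v u); ring.
  exact: gen.
(* The quadratic part of s xi gives 20 l, and 60 (s xi)^2 gives 60 * 20^2 * (18/5)^2 l^2 = 311040
   l^2; since l >= 1, both fit in 313000 l^2. *)
pose kap := 313 * 10 ^+ 3 * l ^+ 2 * al ^+ 2 / r ^+ 2.
have kap0 : 0 <= kap.
  apply: divr_ge0; last exact: sqr_ge0.
  apply: mulr_ge0; last exact: sqr_ge0.
  apply: mulr_ge0; last exact: sqr_ge0.
  by apply: mulr_ge0 => //; exact: exprn_ge0.
have rl : r / (15 * l) <= r / 15.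
  have l15 : 0 < 15 * l by rewrite mulr_gt0.
  by rewrite ler_wpM2l ?(ltW r_gt0)// lef_pV2 ?posrE// ler_peMr.
(* The 18/5 is 7/2 from |V| plus 1/10 for the square, where al |D| <= r / 15. *)
have xi_bound w : `|xi w| <= 18 / 5 * r * (al * enorm (D w)).
  have hD := D_small w; have aD0 : 0 <= al * enorm (D w).
    by rewrite mulr_ge0 ?enorm_ge0// ltW.
  have h1 : al * dot (D w) V <= 7 / 2 * r * (al * enorm (D w)).
    rewrite mulrCA ler_wpM2l ?(ltW al_gt0)//; apply: le_trans (dot_le _ _) _.
    by rewrite mulrC ler_wpM2r ?enorm_ge0.
  have h2 : - (al * dot (D w) V) <= 7 / 2 * r * (al * enorm (D w)).
    rewrite mulrCA -mulrN ler_wpM2l ?(ltW al_gt0)//; apply: le_trans (dotN_le _ _) _.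
    by rewrite mulrC ler_wpM2r ?enorm_ge0.
  have h3 : 0 <= mu * (al ^+ 2 * dot (D w) (D w)).
    by apply: mulr_ge0 => //; apply: mulr_ge0; [exact: sqr_ge0|exact: dotvv_ge0].
  have h4 : mu * (al ^+ 2 * dot (D w) (D w)) <= 1 / 10 * r * (al * enorm (D w)).
    rewrite -enorm_sqr -exprMn; move: hD aD0; set v := al * enorm (D w) => hD aD0.
    have : v * v <= r / 15 * v by rewrite ler_wpM2r// (le_trans hD).
    have : mu * v ^+ 2 <= v ^+ 2 by rewrite ler_piMl ?sqr_ge0.
    have : 0 <= r * v by rewrite mulr_ge0// ltW.
    by rewrite expr2; lra.
  by rewrite /xi mulNr ler_norml; apply/andP; split; lra.
have sxi_small w : `|s * xi w| <= 6.
  rewrite normrM ger0_norm//.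
  apply: le_trans (ler_wpM2l s0 (le_trans (xi_bound w) (ler_wpM2l _ (D_small w)))) _.
    by rewrite mulr_ge0// ltW.
  have -> : s * (18 / 5 * r * (r / (15 * l))) = 24 / 5.
    by rewrite /s; field; rewrite !lt0r_neq0.
  lra.
have hquad w : expR (s * xi w) <=
    1 + dot (- (s * al) *: V) (D w) + kap * dot (D w) (D w).
  apply: le_trans (expR_quad (sxi_small w)) _.
  have xi2 : xi w ^+ 2 <= (18 / 5 * r) ^+ 2 * (al ^+ 2 * dot (D w) (D w)).
    rewrite -enorm_sqr -!exprMn -(real_normK (num_real (xi w))) ler_sqr ?nnegrE ?xi_bound//.
    by rewrite !mulr_ge0 ?enorm_ge0// ltW.
  have hxi : s * xi w <= dot (- (s * al) *: V) (D w) + s * (al ^+ 2 * dot (D w) (D w)).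
    rewrite /xi dotZl (dotC V) mulrDr; apply: lerD.
      by rewrite mulrA mulrN mulNr.
    apply: ler_wpM2l => //; apply: ler_piMl => //.
    by apply: mulr_ge0; [exact: sqr_ge0|exact: dotvv_ge0].
  have h2 : 60 * (s * xi w) ^+ 2 <=
      60 * s ^+ 2 * ((18 / 5 * r) ^+ 2 * (al ^+ 2 * dot (D w) (D w))).
    rewrite exprMn mulrA; apply: ler_wpM2l => //.
    by apply: mulr_ge0 => //; exact: sqr_ge0.
  have h3 : (s + 60 * s ^+ 2 * (18 / 5 * r) ^+ 2) * al ^+ 2 <= kap.
    have -> : kap = 313 * 10 ^+ 3 * l ^+ 2 / r ^+ 2 * al ^+ 2 by rewrite /kap; ring.
    apply: ler_wpM2r; first exact: sqr_ge0.
    have -> : s + 60 * s ^+ 2 * (18 / 5 * r) ^+ 2 = (20 * l + 3888 * 80 * l ^+ 2) / r ^+ 2.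
      by rewrite /s; field; rewrite lt0r_neq0.
    apply: ler_wpM2r; first by rewrite invr_ge0 sqr_ge0.
    by have := l_ge1; nra.
  have h4 : (s + 60 * s ^+ 2 * (18 / 5 * r) ^+ 2) * al ^+ 2 * dot (D w) (D w) <=
      kap * dot (D w) (D w) by rewrite ler_wpM2r ?dotvv_ge0.
  lra.
have mxi : measurable_fun setT xi.
  apply: measurable_funD.
    apply: measurable_funM => //; apply: measurable_dot => i //.
    exact: measurable_coordB.
  apply: measurable_funM => //; apply: measurable_funM => //.
  by apply: measurable_dot => i; exact: measurable_coordB.
have mexp : measurable_fun setT (fun w => expR (s * xi w)).
  by apply: measurableT_comp => //; exact: measurable_funM.
have E1 := quadratic_bound_mean X_bv lam_gt0 mean_small kap0 mexp
  (fun w => expR_ge0 _) hquad.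
under eq_integral do rewrite split_exp expRD EFinM.
rewrite ge0_integralZl//; last exact/measurable_EFinP.
apply: le_trans (lee_wpmul2l _ E1) _; first by rewrite lee_fin expR_ge0.
rewrite -EFinM lee_fin expRD; apply: ler_pM; rewrite ?expR_ge0//.
- by rewrite addr_ge0// mulr_ge0// sqr_ge0.
- rewrite ler_expR /c0 ler_wpM2l// lerD//.
    rewrite mulNr -mulrN -mulrA ler_wpM2l ?(ltW al_gt0)//.
    apply: le_trans (dotN_le _ _) _.
    by rewrite ler_wpM2r ?enorm_ge0.
  rewrite ler_wpM2l// -enorm_sqr -exprMn ler_sqr ?nnegrE ?mulr_ge0 ?(ltW al_gt0)//.
  by rewrite ler_wpM2l ?(ltW al_gt0).
apply: le_trans (expR_ge1Dx _) _; rewrite ler_expR /kap le_eqVlt; apply/orP; left.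
by apply/eqP; field; rewrite lt0r_neq0.
Qed.

End ClippedNoise.

(** * Maximal inequality for a stopped process *)

Section StoppedSupermartingale.
Context {d : measure_display} {T : measurableType d} {R : realType}.
Variables (P : probability T R) (m : nat -> T -> R).

Fixpoint alive (k : nat) (w : T) : bool :=
  (m k w < 1) && (if k is j.+1 then alive j w else true).

Lemma aliveP k w : reflect (forall j, (j <= k)%N -> m j w < 1) (alive k w).
Proof.
elim: k => [|k ih] /=.
  rewrite andbT; apply: (iffP idP) => [h j|->//].
  by rewrite leqn0 => /eqP ->.
apply: (iffP andP) => [[h1 /ih h2] j|h].
  by rewrite leq_eqVlt => /predU1P[->//|]; rewrite ltnS; exact: h2.
by split; [exact: h | apply/ih => j jk; apply: h; exact: leqW].
Qed.

Lemma measurable_alive k : (forall j, (j <= k)%N -> measurable_fun setT (m j)) ->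
  measurable_fun setT (alive k).
Proof.
elim: k => [|k ih] mm /=; apply: measurable_and => //.
- by apply: measurable_fun_ltr => //; exact: mm.
- by apply: measurable_fun_ltr => //; exact: mm.
- by apply: ih => j jk; apply: mm; exact: leqW.
Qed.

Lemma measurable_alive_if k (f g : T -> R) :
  (forall j, (j <= k)%N -> measurable_fun setT (m j)) ->
  measurable_fun setT f -> measurable_fun setT g ->
  measurable_fun setT (fun w => if alive k w then f w else g w).
Proof. by move=> mm mf mg; apply: measurable_fun_ifT => //; exact: measurable_alive. Qed.

Lemma stopped_maximal_inequality (K : nat) (c : R) :
  (forall k, (k <= K)%N -> measurable_fun setT (m k)) ->
  (forall k w, 0 <= m k w) ->
  (forall w, m 0 w <= c) ->
  (forall k, (k < K)%N ->
    \int[P]_w (if alive k w then m k.+1 w else 0)%:E <=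
    \int[P]_w (if alive k w then m k w else 0)%:E)%E ->
  measurable [set w | ~~ alive K w] /\ (P [set w | ~~ alive K w] <= c%:E)%E.
Proof.
move=> mm m0 mc step.
have mS k : (k <= K)%N -> forall j, (j <= k)%N -> measurable_fun setT (m j).
  by move=> kK j jk; apply: mm; exact: leq_trans kK.
(* The process is frozen at 1 from its first time at or above 1. Its mean stays below c, and it
   equals 1 where the path is not alive, so the mean dominates the probability of exit. *)
have stopped n : (n <= K)%N ->
    (\int[P]_w (if alive n w then m n w else 1)%:E <= c%:E)%E.
  elim: n => [|n ih] nK.
    apply: (@le_trans _ _ (\int[P]_w c%:E)%E); last first.
      by rewrite integral_cst//= [X in (_ * X)%E]probability_setT mule1.
    apply: ge0_le_integral => //.
    - by move=> w _; rewrite lee_fin; case: ifP.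
    - apply/measurable_EFinP; apply: measurable_alive_if => //; [exact: mS|exact: mm].
    - move=> w _; rewrite lee_fin /=; apply: le_trans (mc w).
      by rewrite andbT; case: ltP => // _.
  have nK' := ltnW nK.
  have ma1 : measurable_fun setT (fun w => (if alive n w then m n.+1 w else 0)%:E).
    apply/measurable_EFinP; apply: measurable_alive_if => //; [exact: mS|exact: mm].
  have ma2 : measurable_fun setT (fun w => (if alive n w then m n w else 0)%:E).
    apply/measurable_EFinP; apply: measurable_alive_if => //; [exact: mS|exact: mm].
  have ma3 : measurable_fun setT (fun w => (if alive n w then 0 else 1 : R)%:E).
    by apply/measurable_EFinP; apply: measurable_alive_if => //; exact: mS.
  apply: le_trans (ih nK').
  have split2 (f : T -> R) : (forall w, 0 <= f w) ->
      measurable_fun setT (fun w => (if alive n w then f w else 0)%:E) ->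
      (\int[P]_w (if alive n w then f w else 1)%:E =
      \int[P]_w (if alive n w then f w else 0)%:E +
      \int[P]_w (if alive n w then 0 else 1 : R)%:E)%E.
    move=> f0 mf; rewrite -ge0_integralD//.
    - by apply: eq_integral => w _; case: ifP; rewrite -EFinD ?addr0 ?add0r.
    - by move=> w _; rewrite lee_fin; case: ifP.
    - by move=> w _; rewrite lee_fin; case: ifP.
  (* A path that exits at time n + 1 has m at least 1 there, so freezing it at 1 only lowers the
     integrand. *)
  apply: (@le_trans _ _ (\int[P]_w (if alive n w then m n.+1 w else 1)%:E)%E).
    apply: ge0_le_integral => //.
    - by move=> w _; rewrite lee_fin; case: ifP.
    - apply/measurable_EFinP; apply: measurable_alive_if => //; [exact: mS|exact: mm].
    - by apply/measurable_EFinP; apply: measurable_alive_if => //; [exact: mS|exact: mm].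
    - move=> w _; rewrite lee_fin /=.
      by case: (alive n w); rewrite ?andbT ?andbF//; case: ltP.
  rewrite (split2 _ (m0 n.+1) ma1) (split2 _ (m0 n) ma2).
  by rewrite leeD2r// step.
have mD : measurable [set w | ~~ alive K w].
  have := measurable_alive (mS K (leqnn K)) => /(_ measurableT [set false] I).
  rewrite setTI; congr measurable; apply/seteqP.
  by split => w /=; case: (alive K w).
split => //; apply: le_trans (stopped K (leqnn K)).
have -> : P [set w | ~~ alive K w] = (\int[P]_w (\1_[set w | ~~ alive K w] w)%:E)%E.
  by rewrite integral_indic// setIT.
apply: ge0_le_integral => //.
- by apply/measurable_EFinP.
- by apply/measurable_EFinP; apply: measurable_alive_if => //; exact: mm.
- move=> w _; rewrite lee_fin indicE; case: (boolP (alive K w)) => aw.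
    by rewrite memNset//= => /negP.
  by rewrite mem_set.
Qed.

End StoppedSupermartingale.

(** * Consequences of the lower bound on [a] *)

Section StepParameters.
Context {R : realType}.
Variables (K : nat) (delta L r b sig a : R).
Hypotheses (K_gt0 : (0 < K)%N) (delta_gt0 : 0 < delta) (delta_le1 : delta <= 1).
Hypotheses (L_gt0 : 0 < L) (r_gt0 : 0 < r) (b_ge0 : 0 <= b) (sig_ge0 : 0 <= sig).
Hypothesis a_big : sstm_a_min K delta L r b sig <= a.
Let l := ln (4 * K%:R / delta).

Lemma expR1_le : expR 1 <= 10 / 3 :> R.
Proof.
have h : expR (1 / 4) <= 27 / 20 :> R.
  by apply: le_trans (expR_quad_base _) _; lra.
have -> : 1 = 4%:R * (1 / 4) :> R by lra.
rewrite expRM_natl; apply: (@le_trans _ _ ((27 / 20) ^+ 4)); last by lra.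
by rewrite lerXn2r ?nnegrE ?expR_ge0//; lra.
Qed.

Let K1 : 1 <= K%:R :> R. Proof. by rewrite ler1n. Qed.

Lemma log_arg_ge : 4 * K%:R <= 4 * K%:R / delta.
Proof. by rewrite ler_pdivlMr// ler_piMr// mulr_ge0. Qed.

Let arg_gt0 : 0 < 4 * K%:R / delta.
Proof. by apply: lt_le_trans log_arg_ge; have := K1; lra. Qed.

Lemma log_ge1 : 1 <= l.
Proof.
rewrite -ler_expR lnK ?posrE//; apply: le_trans log_arg_ge.
by apply: le_trans expR1_le _; have := K1; lra.
Qed.

Lemma log_ge5 : 159 <= K%:R :> R -> 5 <= l.
Proof.
move=> K159; rewrite -ler_expR lnK ?posrE//; apply: le_trans log_arg_ge.
have -> : 5 = 5%:R * 1 :> R by rewrite mulr1.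
rewrite expRM_natl; apply: (@le_trans _ _ ((10 / 3) ^+ 5)).
  by rewrite lerXn2r ?nnegrE ?expR_ge0 ?expR1_le//; lra.
by lra.
Qed.

Lemma expRN_log : expR (- l) <= delta / 4.
Proof.
rewrite expRN lnK ?posrE// invf_div ler_pM2l// lef_pV2 ?posrE ?mulr_gt0 ?ltr0n//.
by have := K1; lra.
Qed.

Let l0 : 0 < l. Proof. exact: lt_le_trans log_ge1. Qed.
Let K0 : 0 < K%:R :> R. Proof. by rewrite ltr0n. Qed.

Lemma a_ge_log : 972 * 10 ^+ 2 * l ^+ 2 <= a.
Proof. by apply: le_trans a_big; rewrite /sstm_a_min le_max lexx. Qed.

Lemma a_ge_log1 : 972 * 10 ^+ 2 * l <= a.
Proof.
have := a_ge_log; have c0 : 0 < 972 * 10 ^+ 2 :> R by lra.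
move: (972 * 10 ^+ 2) c0 => c c0; apply: le_trans.
by rewrite ler_pM2l// expr2 ler_peMr ?log_ge1// ltW.
Qed.

Lemma a_ge : 972 * 10 ^+ 2 <= a.
Proof.
have := a_ge_log1; have c0 : 0 < 972 * 10 ^+ 2 :> R by lra.
move: (972 * 10 ^+ 2) c0 => c c0; apply: le_trans.
by rewrite ler_peMr ?log_ge1// ltW.
Qed.

Lemma a_gt0 : 0 < a.
Proof.
have c0 : 0 < 972 * 10 ^+ 2 :> R by lra.
exact: lt_le_trans c0 a_ge.
Qed.

Let aL0 : 0 < a * L. Proof. by rewrite mulr_gt0 ?a_gt0. Qed.

Lemma a_ge_sigma :
  18 * 10 ^+ 2 * sig * K.+1%:R * Num.sqrt K%:R * Num.sqrt l <= a * L * r.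
Proof.
rewrite -(mulrA a) -ler_pdivrMr ?mulr_gt0//; apply: le_trans a_big.
by rewrite /sstm_a_min !le_max lexx orbT.
Qed.

Lemma a_ge_bias : 4 * b * K.+2%:R ^+ 2 <= 15 * (a * L * r).
Proof.
have h : 4 * b * K.+2%:R ^+ 2 / (15 * L * r) <= a.
  by apply: le_trans a_big; rewrite /sstm_a_min !le_max lexx !orbT.
by move: h; rewrite ler_pdivrMr ?mulr_gt0//; lra.
Qed.

Lemma a_ge_bias_log : 60 * b * K.+2%:R * l <= a * L * r.
Proof.
rewrite -(mulrA a) -ler_pdivrMr ?mulr_gt0//; apply: le_trans a_big.
by rewrite /sstm_a_min !le_max lexx !orbT.
Qed.

Lemma alphaE k : sstm_alpha a L k.+1 = (k%:R + 2) / (2 * (a * L)).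
Proof. by rewrite /sstm_alpha -(natr1 k.+1) -(natr1 k) -mulrA; congr (_ / _); ring. Qed.

Lemma AE k : sstm_A a L k = k%:R * (k%:R + 3) / (4 * (a * L)).
Proof.
rewrite /sstm_A; elim: k => [|k ih].
  by rewrite big_nat1 /= !mul0r.
rewrite big_nat_recr//= -/(sstm_alpha a L k.+1) ih alphaE -(natr1 k).
by field; rewrite !lt0r_neq0// a_gt0.
Qed.

Lemma AS k : sstm_A a L k.+1 = sstm_A a L k + sstm_alpha a L k.+1.
Proof. by rewrite /sstm_A big_nat_recr. Qed.

Lemma alpha_gt0 k : 0 < sstm_alpha a L k.+1.
Proof. by rewrite alphaE; apply: divr_gt0; [exact: ltr_wpDl | exact: mulr_gt0]. Qed.

Lemma A_ge0 k : 0 <= sstm_A a L k.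
Proof.
rewrite AE; apply: divr_ge0; last by rewrite mulr_ge0// ltW.
by rewrite mulr_ge0// addr_ge0.
Qed.

Lemma A_gt0 k : (0 < k)%N -> 0 < sstm_A a L k.
Proof. move=> k0; rewrite AE; apply: divr_gt0; last exact: mulr_gt0.
by apply: mulr_gt0; [rewrite ltr0n | exact: ltr_wpDl]. Qed.

Lemma A_mono j k : (j <= k)%N -> sstm_A a L j <= sstm_A a L k.
Proof.
move=> /subnK <-; elim: (k - j)%N => // i ih; rewrite addSn AS.
by apply: le_trans ih _; rewrite lerDl ltW ?alpha_gt0.
Qed.

Lemma alpha_sqr_le k : a * L * sstm_alpha a L k.+1 ^+ 2 <=
  sstm_A a L k + sstm_alpha a L k.+1.
Proof.
rewrite -AS AE alphaE -(natr1 k).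
have -> : a * L * ((k%:R + 2) / (2 * (a * L))) ^+ 2 = (k%:R + 2) ^+ 2 / (4 * (a * L)).
  by field; rewrite !lt0r_neq0// a_gt0.
rewrite ler_wpM2r ?invr_ge0 ?mulr_ge0 ?(ltW a_gt0) ?(ltW L_gt0)//.
have k0 : 0 <= k%:R :> R by [].
by nra.
Qed.

Lemma lambda_gt0 k : 0 < sstm_lambda a L K delta r k.
Proof.
rewrite /sstm_lambda -/l; apply: divr_gt0 => //; apply: mulr_gt0 => //.
by apply: mulr_gt0 => //; exact: alpha_gt0.
Qed.

Lemma alpha_lambda k :
  sstm_alpha a L k.+1 * sstm_lambda a L K delta r k = r / (30 * l).
Proof.
rewrite /sstm_lambda -/l; field.
by rewrite (lt0r_neq0 l0) lt0r_neq0// alpha_gt0.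
Qed.

Lemma lambdaE k : sstm_lambda a L K delta r k =
  a * L * r / (15 * (k%:R + 2) * l).
Proof.
have k2 : k%:R + 2 != 0 :> R by rewrite lt0r_neq0// ltr_wpDl.
rewrite /sstm_lambda alphaE -/l; field.
by rewrite k2 !lt0r_neq0// a_gt0.
Qed.

Let natK k : (k < K)%N -> k%:R + 1 <= K%:R :> R.
Proof. by move=> kK; rewrite natr1 ler_nat. Qed.

Lemma bias_le_lambda k : (k < K)%N -> b <= sstm_lambda a L K delta r k / 4.
Proof.
move=> kK; rewrite lambdaE -mulrA -invfM ler_pdivlMr; last first.
  by rewrite !mulr_gt0// ltr_wpDl.
apply: le_trans a_ge_bias_log; rewrite -(natr1 K.+1) -(natr1 K).
have := natK kK; have : 0 <= k%:R :> R by [].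
have bl : 0 <= b * l by rewrite mulr_ge0// ltW.
by nra.
Qed.

Lemma alpha_le k : (k < K)%N -> sstm_alpha a L k.+1 <= (K%:R + 1) / (2 * (a * L)).
Proof.
move=> kK; rewrite alphaE ler_wpM2r ?invr_ge0 ?mulr_ge0 ?(ltW a_gt0) ?(ltW L_gt0)//.
by have := natK kK; lra.
Qed.

(** The square of the second term of the maximum, with 1296 * 10^4 = 4 * 1800^2. Summed over K steps
    the variances are of order R^2 / l, hence of order l in the exponent. *)
Lemma alpha_sigma k : (k < K)%N ->
  sstm_alpha a L k.+1 ^+ 2 * sig ^+ 2 <= r ^+ 2 / (1296 * 10 ^+ 4 * K%:R * l).
Proof.
move=> kK; rewrite -exprMn.
have h : sstm_alpha a L k.+1 * sig <= (K%:R + 1) / (2 * (a * L)) * sig.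
  by rewrite ler_wpM2r// alpha_le.
apply: (@le_trans _ _ (((K%:R + 1) / (2 * (a * L)) * sig) ^+ 2)).
  have al0 := ltW (alpha_gt0 k).
  have q0 : 0 <= (K%:R + 1) / (2 * (a * L)) := le_trans al0 (alpha_le kK).
  by rewrite ler_sqr ?nnegrE//; apply: mulr_ge0.
have := a_ge_sigma; rewrite -(natr1 K) => h1.
have h2 : (18 * 10 ^+ 2 * sig * (K%:R + 1) * Num.sqrt K%:R * Num.sqrt l) ^+ 2 <=
    (a * L * r) ^+ 2.
  have c0 : 0 <= 18 * 10 ^+ 2 :> R by lra.
  rewrite ler_sqr ?nnegrE; [exact: h1| |by rewrite mulr_ge0// ltW].
  apply: mulr_ge0; last exact: sqrtr_ge0.
  apply: mulr_ge0; last exact: sqrtr_ge0.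
  apply: mulr_ge0; last exact: addr_ge0.
  exact: mulr_ge0.
rewrite !exprMn !sqr_sqrtr ?(ltW l0)// in h2.
have [c cE] : exists c : R, c = 1296 * 10 ^+ 4 by eexists.
have c0 : 0 < c by rewrite cE; lra.
have c18 : c = 4 * (18 ^+ 2 * (10 ^+ 2) ^+ 2) by rewrite cE; lra.
rewrite -cE; clear cE; rewrite ler_pdivlMr; last by do 2 apply: mulr_gt0 => //.
have -> : ((K%:R + 1) / (2 * (a * L)) * sig) ^+ 2 * (c * K%:R * l) =
   (c / 4 * sig ^+ 2 * (K%:R + 1) ^+ 2 * K%:R * l) / (a * L) ^+ 2.
  by field; rewrite !lt0r_neq0// a_gt0.
rewrite ler_pdivrMr ?exprn_gt0// [leRHS]mulrC exprMn.
by apply: le_trans h2 => {h1 h}; rewrite c18 le_eqVlt; apply/orP; left; apply/eqP; field.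
Qed.

(* The part of the clipping bias caused by the variance: al sigma^2 / lambda. *)
Definition bias_slack := r / (432 * 10 ^+ 3 * K%:R).

Lemma bias_slack_ge0 : 0 <= bias_slack.
Proof.
have c0 : 0 <= 432 * 10 ^+ 3 :> R by lra.
by apply: divr_ge0 (ltW r_gt0) _; exact: mulr_ge0.
Qed.

Lemma bias_slack_le : bias_slack <= r / K%:R / 1000.
Proof.
have -> : r / K%:R / 1000 = r / (K%:R * 1000) by rewrite invfM mulrA.
rewrite /bias_slack; apply: ler_wpM2l; first exact: ltW.
have c0 : 0 < 432 * 10 ^+ 3 :> R by lra.
have h : K%:R * 1000 <= 432 * 10 ^+ 3 * K%:R :> R by have := K1; lra.
rewrite lef_pV2 ?posrE; [exact: h|exact: mulr_gt0|].
apply: mulr_gt0; [exact: K0 | lra].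
Qed.

Lemma alpha_beta k : (k < K)%N ->
  sstm_alpha a L k.+1 * (b + sig ^+ 2 / sstm_lambda a L K delta r k) <=
  sstm_alpha a L k.+1 * b + bias_slack.
Proof.
move=> kK; rewrite mulrDr lerD2l.
have h := alpha_sigma kK; have al := alpha_gt0 k.
have -> : sstm_alpha a L k.+1 * (sig ^+ 2 / sstm_lambda a L K delta r k) =
  (30 * l / r) * (sstm_alpha a L k.+1 ^+ 2 * sig ^+ 2).
  rewrite /sstm_lambda -/l; field.
  by rewrite (lt0r_neq0 al) (lt0r_neq0 l0) (lt0r_neq0 r_gt0).
have c0 : 0 < 1296 * 10 ^+ 4 :> R by lra.
apply: le_trans (ler_wpM2l _ h) _.
  by rewrite divr_ge0 ?mulr_ge0 ?(ltW l0) ?(ltW r_gt0).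
rewrite /bias_slack le_eqVlt; apply/orP; left; apply/eqP; field.
by rewrite (lt0r_neq0 l0) (lt0r_neq0 r_gt0) (lt0r_neq0 K0).
Qed.

(** The third term of the maximum makes the bias of one step O(R / K), so that its squares are
    negligible; the fourth term gives, in [alpha_b_log], the bound R / 4 required by
    [clipped_noise_mgf] also when K is small. *)
Lemma alpha_b_K k : (k < K)%N ->
  sstm_alpha a L k.+1 * b + bias_slack <= 2 * r / K%:R.
Proof.
move=> kK; have h1 : sstm_alpha a L k.+1 * b <= 15 / 8 * (r / K%:R).
  apply: (@le_trans _ _ ((K%:R + 1) / (2 * (a * L)) * b)).
    by rewrite ler_wpM2r// alpha_le.
  rewrite mulrAC ler_pdivrMr ?mulr_gt0 ?a_gt0//.
  have -> : 15 / 8 * (r / K%:R) * (2 * (a * L)) = 15 * (a * L * r) / (4 * K%:R).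
    by field; rewrite lt0r_neq0.
  rewrite ler_pdivlMr ?mulr_gt0//; apply: le_trans a_ge_bias.
  by rewrite -(natr1 K.+1) -(natr1 K); have := K1; have := b_ge0; nra.
have rK0 : 0 <= r / K%:R by rewrite divr_ge0 ?(ltW r_gt0).
by have := bias_slack_le; have := r_gt0; lra.
Qed.

Lemma alpha_b_log k : (k < K)%N ->
  sstm_alpha a L k.+1 * b + bias_slack <= r / 4.
Proof.
move=> kK; have h1 : sstm_alpha a L k.+1 * b <= r / 120.
  apply: (@le_trans _ _ ((K%:R + 1) / (2 * (a * L)) * b)).
    by rewrite ler_wpM2r// alpha_le.
  rewrite mulrAC ler_pdivrMr ?mulr_gt0 ?a_gt0//.
  have h := a_ge_bias_log; move: h; rewrite -(natr1 K.+1) -(natr1 K).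
  have : b * (K%:R + 1) <= b * (K%:R + 1 + 1) * l.
    rewrite -mulrA ler_wpM2l// -[leLHS]mulr1 ler_pM ?addr_ge0 ?log_ge1//.
    by rewrite lerDl.
  by lra.
have h2 : r / K%:R <= r by rewrite ler_pdivrMr// ler_peMr// ltW.
by have := bias_slack_le; have := r_gt0; lra.
Qed.

(** Follows from K (K + 3) <= (K + 2)^2 and the third term of the maximum. *)
Lemma A_b_le : sstm_A a L K * b <= 15 / 16 * r.
Proof.
rewrite AE mulrAC ler_pdivrMr ?mulr_gt0 ?a_gt0//.
have := a_ge_bias; rewrite -(natr1 K.+1) -(natr1 K).
by have := K1; have := b_ge0; nra.
Qed.

Lemma A_b_le_log : sstm_A a L K * b * (240 * l) <= (K%:R + 1) * r.
Proof.
rewrite AE (_ : _ * b * _ = K%:R * (K%:R + 3) * (60 * b * l) / (a * L)); last first.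
  by field; rewrite !lt0r_neq0// a_gt0.
rewrite ler_pdivrMr//.
have := a_ge_bias_log; rewrite -(natr1 K.+1) -(natr1 K) => h.
have h1 : (60 * b * (K%:R + 1 + 1) * l) * (K%:R + 1) <= a * L * r * (K%:R + 1).
  by rewrite ler_wpM2r// addr_ge0.
have bl : 0 <= b * l by rewrite mulr_ge0// ltW.
by nra.
Qed.

Lemma alpha_le_A k : (k < K)%N ->
  sstm_alpha a L k.+1 * K%:R <= 2 * sstm_A a L K.
Proof.
move=> kK; apply: (@le_trans _ _ ((K%:R + 1) / (2 * (a * L)) * K%:R)).
  by rewrite ler_wpM2r// alpha_le.
rewrite AE -subr_ge0.
have -> : 2 * (K%:R * (K%:R + 3) / (4 * (a * L))) -
    (K%:R + 1) / (2 * (a * L)) * K%:R = K%:R / (a * L).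
  by field; rewrite !lt0r_neq0// a_gt0.
by rewrite divr_ge0// ltW.
Qed.

End StepParameters.

(** * Drift of the refined potential *)

Section RefinedDrift.
Context {R : realType} {d : nat}.
Implicit Types Z Y : 'rV[R]_d.

(* The weight 2 + 2 (1 - t)^2 makes the form semidefinite on [0, 1], with
   vanishing discriminant at t = 0. *)
Lemma refined_form_ge0 Z Y (t : R) : 0 <= t -> t <= 1 ->
  dot ((3 - t) / 2 *: Z - 2^-1 *: Y) ((3 - t) / 2 *: Z - 2^-1 *: Y) <= (2 + 2 * (1 - t) ^+ 2) *
    (3 / 4 * dot Z Z - (3 - 2 * t) / 4 * dot Y Z + 4^-1 * dot Y Y).
Proof.
move=> t0 t1.
have [u tu] : exists u, t = 1 - u by exists (1 - t); lra.
have u0 : 0 <= u by lra.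
have u1 : 0 <= 1 - u by lra.
(* Right side minus left side is p |Z|^2 + q <Y, Z> + s |Y|^2. *)
pose p := 1 / 2 - u + 5 / 4 * u ^+ 2.
pose q := (1 - u - u ^+ 2 - 2 * u ^+ 3) / 2.
pose s := 1 / 4 + u ^+ 2 / 2.
have s0 : 0 < s by rewrite /s; have := sqr_ge0 u; lra.
have disc : 0 <= 4 * p * s - q ^+ 2.
  have -> : 4 * p * s - q ^+ 2 = (1 - u) * ((1 - u) / 4 + 9 / 4 * u ^+ 2 +
      3 / 4 * u ^+ 3 + 2 * u ^+ 4 + u ^+ 5) by rewrite /p /q /s; field.
  apply: mulr_ge0 => //.
  have := exprn_ge0 2 u0; have := exprn_ge0 3 u0; have := exprn_ge0 4 u0.
  by have := exprn_ge0 5 u0; lra.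
(* Completing the square: 4 s times the form is |2 s Y + q Z|^2 + (4 p s - q^2) |Z|^2. *)
have := dotvv_ge0 (2 * s *: Y + q *: Z); rewrite !dotE (dotC Z Y) => h.
have hZ : 0 <= (4 * p * s - q ^+ 2) * dot Z Z by rewrite mulr_ge0 ?dotvv_ge0.
have : 0 <= 4 * s * (p * dot Z Z + q * dot Y Z + s * dot Y Y) by lra.
rewrite pmulr_rge0; last by rewrite mulr_gt0.
by rewrite tu /p /q /s; lra.
Qed.

(** By Young, B r |v| <= r^2 B^2 / 4 val + |v|^2 / val, and [refined_form_ge0] pays the last term
    with the negative drift. The remaining 4/100 r^2 covers the replacement of Z' by Z and the terms
    of order tau. *)
Lemma refined_drift Z Z' Y (r t tau B : R) : 0 < r -> 0 <= t -> 0 <= tau ->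
  t + tau <= 1 -> tau <= 1 / 390 -> 0 <= B -> B <= 15 / 16 ->
  enorm Z <= 2 * r -> enorm Y <= 2 * r -> enorm (Z' - Z) <= r / 150 ->
  - 4^-1 * dot Z Z - 2^-1 * dot Z' Z' + (3 - 2 * (t + tau)) / 4 * dot Y Z'
    - 4^-1 * dot Y Y + (3 - 2 * (t + tau)) / 8 * tau * dot Z' Z'
    + B * r * enorm ((3 - t - tau) / 2 *: Z - 2^-1 *: Y) <=
  r ^+ 2 * (B ^+ 2 / 4 * (2 + 2 * (1 - t) ^+ 2) + 4 / 100).
Proof.
move=> r0 t0 tau0 tt1 tau_le B0 B1 Zr Yr Dr.
have r00 := ltW r0.
set D := Z' - Z in Dr; have eZ' : Z' = Z + D by rewrite /D addrC subrK.
clearbody D; subst Z'.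
pose v := (3 - t) / 2 *: Z - 2^-1 *: Y.
have vE : (3 - t - tau) / 2 *: Z - 2^-1 *: Y = v - (tau / 2) *: Z.
  rewrite /v [RHS]addrAC -scalerBl; congr (_ *: _ - _); lra.
have hv : enorm ((3 - t - tau) / 2 *: Z - 2^-1 *: Y) <= enorm v + tau * r.
  rewrite vE; apply: le_trans (enormB _ _) _; rewrite lerD2l enormZ ger0_norm; last by lra.
  have : tau / 2 * enorm Z <= tau / 2 * (2 * r) by rewrite ler_wpM2l//; lra.
  by lra.
pose val := 2 + 2 * (1 - t) ^+ 2.
have val0 : 0 < val by rewrite /val; have := sqr_ge0 (1 - t); lra.
have form : dot v v <= val *
    (3 / 4 * dot Z Z - (3 - 2 * t) / 4 * dot Y Z + 4^-1 * dot Y Y).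
  by apply: refined_form_ge0 => //; lra.
have young : B * r * enorm v <= r ^+ 2 * (B ^+ 2 / 4 * val) +
    (3 / 4 * dot Z Z - (3 - 2 * t) / 4 * dot Y Z + 4^-1 * dot Y Y).
  rewrite -(ler_pM2l val0).
  have := sqr_ge0 (B * r * val / 2 - enorm v); rewrite -enorm_sqr in form.
  by move: form; move: (enorm v) => ev; nra.
have ZD : - dot Z D <= 2 * r * (r / 150).
  by apply: le_trans (dotN_le _ _) _; rewrite ler_pM ?enorm_ge0.
have YD : dot Y D <= 2 * r * (r / 150).
  by apply: le_trans (dot_le _ _) _; rewrite ler_pM ?enorm_ge0.
have YZ : - dot Y Z <= 2 * r * (2 * r).
  by apply: le_trans (dotN_le _ _) _; rewrite ler_pM ?enorm_ge0.
have ZZ' : dot (Z + D) (Z + D) <= 5 * r ^+ 2.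
  have : enorm (Z + D) <= 2 * r + r / 150.
    by apply: le_trans (enormD _ _) _; rewrite lerD.
  by move=> /dot_le_sqr; nra.
have DD := dotvv_ge0 D.
have k0 : 0 <= (3 - 2 * (t + tau)) / 4 by lra.
have k1 : (3 - 2 * (t + tau)) / 4 <= 3 / 4 by lra.
have e1 : (3 - 2 * (t + tau)) / 4 * dot Y D <= 3 / 4 * (2 * r * (r / 150)).
  apply: (@le_trans _ _ ((3 - 2 * (t + tau)) / 4 * (2 * r * (r / 150)))).
    by rewrite ler_wpM2l.
  by rewrite ler_wpM2r// !mulr_ge0// divr_ge0.
have e2 : tau * (- dot Y Z) <= tau * (4 * r ^+ 2) by rewrite ler_wpM2l//; lra.
have e3 : (3 - 2 * (t + tau)) / 8 * tau * dot (Z + D) (Z + D) <=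
    3 / 8 * (tau * (5 * r ^+ 2)).
  rewrite -mulrA; apply: ler_pM; first by lra.
  - by rewrite mulr_ge0 ?dotvv_ge0.
  - by lra.
  - by rewrite ler_wpM2l.
have e4 : B * r * enorm ((3 - t - tau) / 2 *: Z - 2^-1 *: Y) <=
    B * r * enorm v + 15 / 16 * (tau * r ^+ 2).
  apply: (@le_trans _ _ (B * r * (enorm v + tau * r))).
    by rewrite ler_wpM2l// mulr_ge0.
  rewrite mulrDr lerD2l.
  have : B * (tau * r ^+ 2) <= 15 / 16 * (tau * r ^+ 2).
    by rewrite ler_wpM2r// mulr_ge0 ?sqr_ge0.
  by lra.
have e5 : tau * r ^+ 2 <= 1 / 390 * r ^+ 2 by rewrite ler_wpM2r ?sqr_ge0.
move: e3; rewrite !dotE (dotC D Z) => e3.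
move: young; rewrite /val => young.
by have := sqr_ge0 r; lra.
Qed.

End RefinedDrift.

(** * One step of the exponential supermartingale *)

Section OneStep.
Context {R : realType} {d : nat}.
Variables (f : 'rV[R]_d -> R) (xs : 'rV[R]_d).
Variables (K : nat) (delta L r b sig a : R).
Hypothesis xs_min : forall x, f xs <= f x.
Hypothesis smooth : forall x y, eball xs (3 * r) x -> eball xs (3 * r) y ->
  enorm (grad f x - grad f y) <= L * enorm (x - y).
Hypothesis grad_bound : forall x, eball xs (3 * r) x ->
  enorm (grad f x) ^+ 2 <= 2 * L * (f x - inf [set f u | u in eball xs (3 * r)]).
Hypothesis convex : forall x y, eball xs (3 * r) x -> eball xs (3 * r) y ->
  f x + dot (grad f x) (y - x) <= f y.
Hypotheses (K_gt0 : (0 < K)%N) (delta_gt0 : 0 < delta) (delta_le1 : delta <= 1).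
Hypotheses (L_gt0 : 0 < L) (r_gt0 : 0 < r) (b_ge0 : 0 <= b) (sig_ge0 : 0 <= sig).
Hypothesis a_big : sstm_a_min K delta L r b sig <= a.

Let l := ln (4 * K%:R / delta).
Let A k := sstm_A a L k.
Let al k := sstm_alpha a L k.+1.
Let lam k := sstm_lambda a L K delta r k.
Let slack := bias_slack K r.

Let l1 : 1 <= l. Proof. exact: log_ge1. Qed.
Let K1 : 1 <= K%:R :> R. Proof. by rewrite ler1n. Qed.
Let a0 : 0 < a. Proof. exact: (a_gt0 K_gt0 delta_gt0 delta_le1 a_big). Qed.
Let al0 k : 0 < al k.
Proof. exact: (alpha_gt0 K_gt0 delta_gt0 delta_le1 L_gt0 a_big). Qed.
Let A0 k : 0 <= A k.
Proof. exact: (A_ge0 K_gt0 delta_gt0 delta_le1 L_gt0 a_big). Qed.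
Let lam0 k : 0 < lam k.
Proof. exact: (lambda_gt0 K_gt0 delta_gt0 delta_le1 L_gt0 r_gt0 a_big). Qed.
Let slack0 : 0 <= slack. Proof. exact: bias_slack_ge0. Qed.
Let AKgt0 : 0 < A K.
Proof. exact: (A_gt0 K_gt0 delta_gt0 delta_le1 L_gt0 a_big K_gt0). Qed.

(** The factor 53/50 creates the initial margin: (53/50)^2 / 2 exceeds 1/2 + 1/20 + 3/1000. It
    cannot be much larger, as 53/50 + 15/16 + 1/1000 has to stay below 2. *)
Definition radius k := 53 / 50 * r + A k * b + k%:R * slack.

Lemma radiusS k : radius k.+1 = radius k + (al k * b + slack).
Proof. by rewrite /radius /A AS -/(al k) -(natr1 k); ring. Qed.

Lemma radius_mono j k : (j <= k)%N -> radius j <= radius k.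
Proof.
move=> jk; rewrite /radius; apply: lerD.
  rewrite lerD2l ler_wpM2r//.
  exact: (A_mono K_gt0 delta_gt0 delta_le1 L_gt0 a_big).
by rewrite ler_wpM2r// ler_nat.
Qed.

Lemma K_slack : K%:R * slack <= r / 1000.
Proof.
have K0 : 0 < K%:R :> R by rewrite ltr0n.
have h := bias_slack_le K_gt0 r_gt0.
apply: le_trans (ler_wpM2l (ltW K0) h) _.
by rewrite le_eqVlt; apply/orP; left; apply/eqP; field; rewrite lt0r_neq0.
Qed.

Lemma radius_le_2r k : (k <= K)%N -> radius k <= 2 * r.
Proof.
move=> kK; apply: le_trans (radius_mono kK) _.
have h1 : A K * b <= 15 / 16 * r.
  exact: (A_b_le K_gt0 delta_gt0 delta_le1 L_gt0 r_gt0 b_ge0 a_big).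
by rewrite /radius; have := K_slack; have := r_gt0; lra.
Qed.

Lemma radius_ge k : r <= radius k.
Proof.
rewrite /radius; have : 0 <= A k * b by rewrite mulr_ge0.
have : 0 <= k%:R * slack by rewrite mulr_ge0.
by have := r_gt0; lra.
Qed.

Definition energy k (y z : 'rV[R]_d) :=
  A k * (f y - f xs) + 2^-1 * dot (z - xs) (z - xs).

(** The last term loses 3/1000 R^2 / K at every step; this pays for the variance and for the 2 / a
    part of the squared error. *)
Definition potential k y z :=
  energy k y z - radius k ^+ 2 / 2 + (K%:R - k%:R) / K%:R * (3 / 1000 * r ^+ 2).

Lemma potential_bound k y z : (k <= K)%N -> potential k y z < 0 ->
  [/\ enorm (z - xs) <= radius k & A k * (f y - f xs) <= radius k ^+ 2 / 2].
Proof.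
move=> kK p0.
have c0 : 0 <= (K%:R - k%:R) / K%:R * (3 / 1000 * r ^+ 2).
  apply: mulr_ge0; last by have := sqr_ge0 r; lra.
  by rewrite divr_ge0// subr_ge0 ler_nat.
have e : energy k y z <= radius k ^+ 2 / 2 by move: p0; rewrite /potential; lra.
have h1 : 0 <= A k * (f y - f xs) by rewrite mulr_ge0// subr_ge0.
have h2 := dotvv_ge0 (z - xs).
split; last by move: e; rewrite /energy; lra.
apply: enorm_le; first by apply: le_trans (radius_ge k); exact: ltW.
by move: e; rewrite /energy; lra.
Qed.

Definition query k (y z : 'rV[R]_d) := (A k.+1)^-1 *: (A k *: y + al k *: z).
Definition next_z k (z C : 'rV[R]_d) := z - al k *: C.
Definition next_y k (y z C : 'rV[R]_d) :=
  (A k.+1)^-1 *: (A k *: y + al k *: next_z k z C).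

Definition progress k := A k / A K.
Definition bias_mass := A K * b / r.
(* The primitive of 2 + 2 (1 - t)^2, the weight in [refined_form_ge0]. *)
Definition profile (t : R) := 2 * t + 2 / 3 * (1 - (1 - t) ^+ 3).

(** At the start the refined potential is at most 3/4 R^2, so 83/100, less the correction 2/100,
    leaves more than the margin 1/20. At t = 1, where [profile] is 8/3, the subtracted amount is at
    most (2/3 (15/16)^2 + 91/100) R^2 < 3/2 R^2. *)
Definition refined k (y z : 'rV[R]_d) :=
  refined_potential (progress k) (A k * (f y - f xs)) (z - xs)
    (progress k *: (y - xs))
  - r ^+ 2 * (bias_mass ^+ 2 / 4 * profile (progress k)
      + 8 / 100 * progress k + 83 / 100)
  + (K%:R - k%:R) / K%:R * (2 / 100 * r ^+ 2).

(* Outside this regime [potential] alone gives the rate. *)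
Definition slow := 3 * r ^+ 2 < radius K ^+ 2.

(** A bootstrap: rho_K > 1.73 R forces A_K b >= 0.669 R, hence 160 l <= K + 1 by the fourth term of
    the maximum. With l >= 1 this gives K >= 159, so l >= 5, and then K >= 799. *)
Lemma slow_regime : slow -> 5 <= l /\ 780 <= K%:R :> R.
Proof.
rewrite /slow => sl.
have rK : 0 <= radius K by apply: le_trans (radius_ge K); exact: ltW.
have r173 : 173 / 100 * r < radius K.
  rewrite ltNge; apply/negP => le.
  have : radius K ^+ 2 <= (173 / 100 * r) ^+ 2.
    by rewrite ler_sqr ?nnegrE// (le_trans rK le).
  by have := sqr_ge0 r; lra.
have Ab : 669 / 1000 * r <= A K * b.
  by move: r173; rewrite /radius; have := K_slack; lra.
have h := A_b_le_log K_gt0 delta_gt0 delta_le1 L_gt0 r_gt0 b_ge0 a_big.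
rewrite -/(A K) -/l in h.
have l0 : 0 < l by exact: lt_le_trans l1.
have h2 : 160 * l <= K%:R + 1.
  rewrite -(ler_pM2r r_gt0); apply: le_trans h.
  have : 669 / 1000 * r * (240 * l) <= A K * b * (240 * l).
    by apply: ler_wpM2r => //; lra.
  have : 0 <= r * l by rewrite mulr_ge0// ltW.
  lra.
have l5 : 5 <= l.
  by apply: (log_ge5 K_gt0 delta_gt0 delta_le1); have := l1; lra.
by split => //; lra.
Qed.

Section Good.
Variables (k : nat) (y z : 'rV[R]_d).
Hypothesis kK : (k < K)%N.
Hypothesis pot_neg : potential k y z < 0.
Hypothesis y_ball : enorm (y - xs) <= radius k.

Let x := query k y z.
Let g := grad f x.

Let z_ball : enorm (z - xs) <= radius k.
Proof. by have [] := potential_bound (ltnW kK) pot_neg. Qed.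

Let rk : radius k <= 2 * r. Proof. exact: radius_le_2r (ltnW kK). Qed.

Let AS' : A k.+1 = A k + al k. Proof. exact: AS. Qed.

Lemma query_ball : enorm (x - xs) <= radius k.
Proof.
rewrite /x /query AS'; apply: eball_convex => //; first exact: ltW.
exact: ltr_wpDl.
Qed.

Let inQ u : enorm (u - xs) <= 2 * r + r / 30 -> eball xs (3 * r) u.
Proof. by rewrite /eball /= => h; have := r_gt0; lra. Qed.

Let inQk u : enorm (u - xs) <= radius k -> eball xs (3 * r) u.
Proof. by move=> h; apply: inQ; have := rk; have := r_gt0; lra. Qed.

Let xs_ball : eball xs (3 * r) xs.
Proof. by apply: inQ; rewrite subrr enorm0; have := r_gt0; lra. Qed.

Let grad_sqr u : eball xs (3 * r) u -> enorm (grad f u) ^+ 2 <= 2 * L * (f u - f xs).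
Proof.
move=> uQ; apply: le_trans (grad_bound uQ) _.
rewrite ler_wpM2l ?mulr_ge0 ?(ltW L_gt0)// lerB//.
by apply: lb_le_inf; [exists (f xs), xs | move=> _ [v _ <-]].
Qed.

Let grad_xs : enorm (grad f xs) = 0.
Proof.
have := grad_sqr xs_ball; rewrite subrr mulr0 => h.
by apply/eqP; rewrite -sqrf_eq0 eq_le h sqr_ge0.
Qed.

(** For k > 0 the budget is lambda / 5 for L |x - y|, where |x - y| <= 2 / (k + 2) * 4 R, plus 3/10
    lambda for the gradient at y, which the gradient domination inequality bounds through A_k (f(y)
    - f(xs)) <= 2 R^2. *)
Lemma query_gradient : enorm g <= lam k / 2.
Proof.
have a1 := a_ge_log1 K_gt0 delta_gt0 delta_le1 a_big; rewrite -/l in a1.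
have a2 := a_ge_log a_big; rewrite -/l in a2.
have lE : lam k = a * L * r / (15 * (k%:R + 2) * l).
  exact: (lambdaE K_gt0 delta_gt0 delta_le1 L_gt0 a_big).
have k0 : 0 <= k%:R :> R by [].
have k2 : 0 < k%:R + 2 :> R by lra.
have l0 : 0 < l by exact: lt_le_trans l1.
have Lr : 0 < L * r by rewrite mulr_gt0.
have small (c : R) : 0 <= c -> c <= 8 -> c * (L * r) / (k%:R + 2) <= lam k / 5.
  move=> c0 c8; rewrite lE ler_pdivrMr//.
  have -> : a * L * r / (15 * (k%:R + 2) * l) / 5 * (k%:R + 2) = a / (75 * l) * (L * r).
    by field; rewrite !lt0r_neq0.
  rewrite ler_wpM2r ?(ltW Lr)// ler_pdivlMr; last by rewrite mulr_gt0.
  by have : c * l <= 8 * l by [rewrite ler_wpM2r// ltW]; lra.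
have xQ := inQk query_ball.
(* A_0 = 0 gives no control of f(y^0); for k = 0 smoothness is applied between x and xs, where the
   gradient vanishes. *)
case: (posnP k) => [k00|kpos].
  have h : enorm g <= L * enorm (x - xs).
    apply: le_trans (smooth xQ xs_ball).
    have := enormB (grad f x - grad f xs) (- grad f xs).
    rewrite enormN grad_xs addr0 opprK subrK; exact.
  have h2 : L * enorm (x - xs) <= L * (2 * r).
    by rewrite ler_wpM2l ?(ltW L_gt0)//; apply: le_trans query_ball _.
  have := @small 4; rewrite k00 add0r => /(_ _ _); have := lam0 k; rewrite k00.
  by move=> lam00 /(_ ltac:(lra) ltac:(lra)); lra.
have yQ := inQk y_ball.
have h : enorm g <= L * enorm (x - y) + enorm (grad f y).
  apply: le_trans (lerD (smooth xQ yQ) (lexx _)).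
  by have := enormD (grad f x - grad f y) (grad f y); rewrite subrK.
have h1 : L * enorm (x - y) <= lam k / 5.
  apply: le_trans (small 8 _ _) => //.
  have -> : x - y = (al k / A k.+1) *: (z - y).
    have An : A k.+1 != 0 by rewrite AS' lt0r_neq0// ltr_wpDl.
    rewrite /x /query -[X in _ - X](scalerK An) -scalerBr.
    rewrite [al k / _]mulrC -(scalerA (A k.+1)^-1 (al k)); congr (_ *: _).
    by rewrite AS' scalerDl opprD addrACA subrr add0r scalerBr.
  rewrite enormZ ger0_norm; last by apply: divr_ge0 => //; exact: ltW.
  have zy : enorm (z - y) <= 4 * r.
    have -> : z - y = (z - xs) - (y - xs) by rewrite opprB addrA subrK.
    apply: le_trans (enormB _ _) _.
    by have := z_ball; have := y_ball; have := rk; lra.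
  have q : al k / A k.+1 <= 2 / (k%:R + 2).
    rewrite ler_pdivrMr; last by rewrite AS' ltr_wpDl.
    rewrite /al /A alphaE (AE K_gt0 delta_gt0 delta_le1 L_gt0 a_big) -(natr1 k).
    have -> : 2 / (k%:R + 2) * ((k%:R + 1) * (k%:R + 1 + 3) / (4 * (a * L))) =
       ((k%:R + 1) * (k%:R + 1 + 3) / (k%:R + 2)) / (2 * (a * L)).
      by field; rewrite !lt0r_neq0.
    rewrite ler_wpM2r ?invr_ge0 ?mulr_ge0 ?(ltW a0) ?(ltW L_gt0)//.
    by rewrite ler_pdivlMr//; nra.
  have : L * (al k / A k.+1 * enorm (z - y)) <= L * (2 / (k%:R + 2) * (4 * r)).
    apply: ler_wpM2l; first exact: ltW.
    by apply: ler_pM => //; [apply: divr_ge0 => //; exact: ltW | exact: enorm_ge0].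
  by move=> /le_trans; apply; rewrite le_eqVlt; apply/orP; left; apply/eqP; field; rewrite lt0r_neq0.
have h2 : enorm (grad f y) <= 3 / 10 * lam k.
  rewrite -ler_sqr ?nnegrE ?enorm_ge0//; last by rewrite mulr_ge0// ltW.
  apply: le_trans (grad_sqr yQ) _.
  have [_ fy] := potential_bound (ltnW kK) pot_neg.
  have Ak : 0 < A k by exact: (A_gt0 K_gt0 delta_gt0 delta_le1 L_gt0 a_big).
  have fy2 : A k * (f y - f xs) <= 2 * r ^+ 2.
    apply: le_trans fy _; have r0 := r_gt0; have rr := radius_ge k; have := rk.
    by move: (radius k) rr => q rr rq; nra.
  have fy3 : f y - f xs <= 2 * r ^+ 2 / A k by rewrite ler_pdivlMr// mulrC.
  apply: le_trans (ler_wpM2l _ fy3) _; first by rewrite mulr_ge0// ltW.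
  have kpos1 : 1 <= k%:R :> R by rewrite ler1n.
  rewrite lE /A (AE K_gt0 delta_gt0 delta_le1 L_gt0 a_big).
  have kk0 : 0 < k%:R * (k%:R + 3) :> R by nra.
  have -> : 2 * L * (2 * r ^+ 2 / (k%:R * (k%:R + 3) / (4 * (a * L)))) =
     (L * r) ^+ 2 * (16 * a / (k%:R * (k%:R + 3))).
    by field; rewrite !lt0r_neq0//; lra.
  have -> : (3 / 10 * (a * L * r / (15 * (k%:R + 2) * l))) ^+ 2 =
     (L * r) ^+ 2 * (a * a / (50 ^+ 2 * ((k%:R + 2) * l) ^+ 2)).
    by field; rewrite !lt0r_neq0.
  rewrite ler_wpM2l ?sqr_ge0// ler_pdivrMr// mulrAC ler_pdivlMr; last first.
    by rewrite mulr_gt0// exprn_gt0// mulr_gt0.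
  have -> : 16 * a * (50 ^+ 2 * ((k%:R + 2) * l) ^+ 2) =
     a * (200 ^+ 2 * l ^+ 2 * (k%:R + 2) ^+ 2) by rewrite exprMn; ring.
  rewrite -(mulrA a a); apply: ler_wpM2l; first exact: ltW.
  (* The inequality 4 (k + 2)^2 <= 9 k (k + 3) is an equality at k = 1. The requirement becomes a >=
     300^2 l^2, which 97200 l^2 covers. *)
  have e1 : 200 ^+ 2 * l ^+ 2 * (k%:R + 2) ^+ 2 <= 300 ^+ 2 * l ^+ 2 * (k%:R * (k%:R + 3)).
    have : 4 * (k%:R + 2) ^+ 2 <= 9 * (k%:R * (k%:R + 3)) :> R by nra.
    move=> /(ler_wpM2l (_ : 0 <= 100 ^+ 2 * l ^+ 2)) => /(_ _).
    by have := sqr_ge0 l; move=> ll /(_ ltac:(lra)); lra.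
  apply: le_trans e1 _; rewrite ler_wpM2r ?(ltW kk0)//.
  by apply: le_trans a2; have := sqr_ge0 l; lra.
by have := lam0 k; lra.
Qed.

Let l0 : 0 < l. Proof. exact: lt_le_trans l1. Qed.
Let Kpos : 0 < K%:R :> R. Proof. by rewrite ltr0n. Qed.
Let a_large : 972 * 10 ^+ 2 <= a.
Proof. exact: (a_ge K_gt0 delta_gt0 delta_le1 a_big). Qed.
Let al_lam : al k * lam k = r / (30 * l).
Proof. exact: (alpha_lambda K_gt0 delta_gt0 delta_le1 L_gt0 a_big). Qed.
Let s := 20 * l / r ^+ 2.
Let s0 : 0 <= s.
Proof. by rewrite /s; apply: divr_ge0; [rewrite mulr_ge0// ltW | exact: sqr_ge0]. Qed.

Lemma next_z_dist C : enorm C <= lam k -> enorm (next_z k z C - z) <= r / (30 * l).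
Proof.
move=> Cl; rewrite /next_z addrAC subrr add0r enormN enormZ gtr0_norm//.
by rewrite -al_lam ler_wpM2l// ltW.
Qed.

(** The step inequalities must hold for every outcome of the noise, also one that ends the good
    event; the clipping bound alone keeps the next point inside the ball of radius 3 R. *)
Lemma next_z_ball C : enorm C <= lam k -> enorm (next_z k z C - xs) <= 2 * r + r / 30.
Proof.
move=> Cl; have -> : next_z k z C - xs = (z - xs) + (next_z k z C - z).
  by rewrite [RHS]addrC addrA subrK.
apply: le_trans (enormD _ _) _; apply: lerD; first exact: le_trans rk.
apply: le_trans (next_z_dist Cl) _; apply: ler_wpM2l; first exact: ltW.
by rewrite lef_pV2 ?posrE ?mulr_gt0// ler_peMr.
Qed.

Lemma next_y_ball C : enorm C <= lam k -> enorm (next_y k y z C - xs) <= 2 * r + r / 30.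
Proof.
move=> Cl; rewrite /next_y AS'; apply: eball_convex => //; first exact: ltW.
- exact: ltr_wpDl.
- by apply: le_trans y_ball _; have := rk; have := r_gt0; lra.
- exact: next_z_ball.
Qed.

(** Convexity at y' bounds f y' by f x + <grad f y', y' - x>, and replacing grad f y' by g costs L
    |y' - x|^2. This needs no integration along the segment; the loss against L / 2 disappears in
    the size of [a]. *)
Let next_descent C y' : enorm C <= lam k -> y' = next_y k y z C ->
  f y' <= f x + dot g (y' - x) + L * dot (y' - x) (y' - x).
Proof.
move=> Cl y'E; have yQ : eball xs (3 * r) y' by rewrite y'E; apply: inQ; exact: next_y_ball.
have xQ := inQk query_ball.
have h1 := convex yQ xQ.
have h2 := smooth yQ xQ.
have h3 : dot (grad f y' - g) (y' - x) <= L * dot (y' - x) (y' - x).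
  apply: le_trans (dot_le _ _) _; rewrite -enorm_sqr expr2 mulrA.
  by rewrite ler_wpM2r ?enorm_ge0.
move: h1 h3; rewrite -(opprB y' x) dotNr (dotBl (grad f y')) => h1 h3; lra.
Qed.

Let convex_y : f x + dot g (y - x) <= f y.
Proof. by apply: convex; apply: inQk; [exact: query_ball | ]. Qed.

Let convex_xs : f x + dot g (xs - x) <= f xs.
Proof. by apply: convex; [apply: inQk; exact: query_ball | ]. Qed.

Let A_big : a * L * al k ^+ 2 <= A k + al k.
Proof. exact: (alpha_sqr_le K_gt0 delta_gt0 delta_le1 L_gt0 a_big). Qed.

Let a4 : 4 <= a. Proof. by have := a_large; lra. Qed.

Lemma energy_next C : enorm C <= lam k ->
  energy k.+1 (next_y k y z C) (next_z k z C) <= energy k y z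
  - al k * dot (C - g) (z - xs)
  + (2^-1 + 2 / a) * (al k ^+ 2 * dot (C - g) (C - g)).
Proof.
move=> Cl; have dsc := next_descent Cl erefl.
move: dsc convex_y convex_xs; rewrite /energy /g /x /next_y /query AS' => dsc cy cx.
exact: (energy_step (al0 k) (A0 k) a4 A_big dsc cy cx).
Qed.

Section Estimator.
Context {dT : measure_display} {T : measurableType dT} (P : probability T R).
Variable X : T -> 'rV[R]_d.
Hypothesis X_bv : bias_var_bounded P X g b sig.
Let C w := clip (X w) (lam k).
Let beta := b + sig ^+ 2 / lam k.

Let C_small w : enorm (C w) <= lam k. Proof. exact: enorm_clip. Qed.

Let beta0 : 0 <= beta.
Proof. by rewrite addr_ge0// divr_ge0 ?sqr_ge0// ltW. Qed.

Let al_beta : al k * beta <= al k * b + slack.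
Proof. exact: (alpha_beta K_gt0 delta_gt0 delta_le1 L_gt0 r_gt0 sig_ge0 a_big). Qed.

Let al_b_K : al k * b + slack <= 2 * r / K%:R.
Proof. exact: (alpha_b_K K_gt0 delta_gt0 delta_le1 L_gt0 r_gt0 b_ge0 a_big). Qed.

(** Common to both potentials: the deterministic drift c must pay for the bias along U, its square
    and the variance. The variance costs at most s R^2 / (800 K), because 313 / 12960 < 1 / 40. *)
Lemma exp_step (pot' : T -> R) (pot c mu : R) (U : 'rV[R]_d) :
  measurable_fun setT pot' -> 0 <= mu -> mu <= 1 -> enorm U <= 3 * r ->
  (forall w, pot' w <= pot + c + (- al k * dot (C w - g) U
     + mu * (al k ^+ 2 * dot (C w - g) (C w - g)))) ->
  c + al k * beta * enorm U + mu * (al k * beta) ^+ 2 + r ^+ 2 / (800 * K%:R) <= 0 ->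
  (\int[P]_w (expR (s * pot' w))%:E <= (expR (s * pot))%:E)%E.
Proof.
move=> mpot mu0 mu1 U3 hpot hc.
have bl : b <= lam k / 4.
  exact: (bias_le_lambda K_gt0 delta_gt0 delta_le1 L_gt0 r_gt0 b_ge0 a_big).
have ab : al k * beta <= r / 4.
  apply: le_trans al_beta _.
  exact: (alpha_b_log K_gt0 delta_gt0 delta_le1 L_gt0 r_gt0 b_ge0 a_big).
have mgf := clipped_noise_mgf X_bv (lam0 k) (al0 k) r_gt0 l1 al_lam query_gradient bl
  mu0 mu1 U3 ab.
have mC i : measurable_fun setT (fun w => C w 0 i).
  apply: measurable_clip => j; have [h _ _] := X_bv.
  by apply: (@summable_measurable _ _ _ P); exact: h.
have mN : measurable_fun setT (fun w => - al k * dot (C w - g) U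
     + mu * (al k ^+ 2 * dot (C w - g) (C w - g))).
  apply: measurable_funD; apply: measurable_funM => //.
    by apply: measurable_dot => i //; exact: measurable_coordB.
  apply: measurable_funM => //.
  by apply: measurable_dot => i //; exact: measurable_coordB.
have mE (h : T -> R) : measurable_fun setT h ->
    measurable_fun setT (fun w => (expR (s * h w))%:E).
  by move=> mh; apply/measurable_EFinP; apply: measurableT_comp => //; exact: measurable_funM.
apply: (@le_trans _ _ (\int[P]_w ((expR (s * (pot + c)))%:E *
    (expR (s * (- al k * dot (C w - g) U
     + mu * (al k ^+ 2 * dot (C w - g) (C w - g)))))%:E))%E).
  apply: ge0_le_integral => //.
  - exact: mE.
  - by apply: emeasurable_funM => //; exact: mE.
  - move=> w _; rewrite -EFinM lee_fin -expRD ler_expR -mulrDr.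
    by apply: ler_wpM2l => //; exact: hpot.
rewrite ge0_integralZl//; last exact: mE.
apply: le_trans (lee_wpmul2l _ mgf) _; first by rewrite lee_fin expR_ge0.
rewrite -EFinM lee_fin -expRD ler_expR -/beta -/l -/s.
have noise : 313 * 10 ^+ 3 * l ^+ 2 * (al k ^+ 2 * sig ^+ 2) / r ^+ 2 <=
    s * (r ^+ 2 / (800 * K%:R)).
  have h := alpha_sigma K_gt0 delta_gt0 delta_le1 L_gt0 r_gt0 sig_ge0 a_big kK.
  rewrite -/(al k) -/l in h.
  have c0 : 0 <= 313 * 10 ^+ 3 * l ^+ 2 by have := sqr_ge0 l; lra.
  rewrite ler_pdivrMr ?exprn_gt0//; apply: le_trans (ler_wpM2l c0 h) _.
  have -> : 313 * 10 ^+ 3 * l ^+ 2 * (r ^+ 2 / (1296 * 10 ^+ 4 * K%:R * l)) =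
      313 / (1296 * 10) * (r ^+ 2 * (l / K%:R)).
    by field; rewrite (lt0r_neq0 l0) (lt0r_neq0 Kpos).
  have -> : s * (r ^+ 2 / (800 * K%:R)) * r ^+ 2 = 1 / 40 * (r ^+ 2 * (l / K%:R)).
    by rewrite /s; field; rewrite (lt0r_neq0 r_gt0) (lt0r_neq0 Kpos).
  by apply: ler_wpM2r; [rewrite mulr_ge0 ?sqr_ge0// divr_ge0// ltW | lra].
apply: le_trans (lerD (lexx _) (lerD (lexx _) noise)) _.
rewrite -!mulrDr; apply: ler_wpM2l => //.
by move: hc; lra.
Qed.

(** With q = al b + slack, half the increase of the squared radius is rho_k q + q^2 / 2: it matches
    the bias against |Z| <= rho_k and the leading half of the squared bias. The remainders, of order
    R^2 / K, are covered by the decreasing correction. *)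
Lemma potential_step :
  measurable_fun setT (fun w => potential k.+1 (next_y k y z (C w)) (next_z k z (C w))) ->
  (\int[P]_w (expR (s * potential k.+1 (next_y k y z (C w)) (next_z k z (C w))))%:E
    <= (expR (s * potential k y z))%:E)%E.
Proof.
move=> mpot; pose q := al k * b + slack.
have q0 : 0 <= q by rewrite addr_ge0// mulr_ge0// ltW.
have ai : a^-1 <= (972 * 10 ^+ 2)^-1.
  have c0 : 0 < 972 * 10 ^+ 2 :> R by lra.
  by rewrite lef_pV2 ?posrE; [exact: a_large | exact: a0 | exact: c0].
have ai0 : 0 < a^-1 by rewrite invr_gt0.
apply: (@exp_step _ _ (radius k ^+ 2 / 2 - radius k.+1 ^+ 2 / 2
  - 3 / 1000 * (r ^+ 2 / K%:R)) (2^-1 + 2 / a) (z - xs)).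
- exact: mpot.
- lra.
- by move: ai; lra.
- by apply: le_trans z_ball _; have := rk; have := r_gt0; lra.
- move=> w; have := energy_next (C_small w); rewrite /potential.
  have -> : (K%:R - k.+1%:R) / K%:R * (3 / 1000 * r ^+ 2) =
      (K%:R - k%:R) / K%:R * (3 / 1000 * r ^+ 2) - 3 / 1000 * (r ^+ 2 / K%:R).
    by rewrite -(natr1 k); field; rewrite lt0r_neq0.
  by lra.
rewrite radiusS -/q.
have rho0 : 0 <= radius k by apply: le_trans (radius_ge k); exact: ltW.
have ab0 : 0 <= al k * beta by rewrite mulr_ge0// ltW.
have h1 : al k * beta * enorm (z - xs) <= q * radius k.
  by apply: ler_pM => //; exact: enorm_ge0.
have h2 : (al k * beta) ^+ 2 <= q ^+ 2 by rewrite ler_sqr ?nnegrE.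
have h3 : q ^+ 2 <= 4 * (r ^+ 2 / K%:R).
  have h : q ^+ 2 <= (2 * r / K%:R) ^+ 2.
    by rewrite ler_sqr ?nnegrE; [exact: al_b_K|exact: q0|exact: le_trans al_b_K].
  apply: le_trans h _.
  have -> : (2 * r / K%:R) ^+ 2 = 4 * (r ^+ 2 / K%:R) * K%:R^-1.
    by field; rewrite lt0r_neq0.
  have Ki : K%:R^-1 <= 1 :> R by rewrite invf_le1.
  have rK : 0 <= 4 * (r ^+ 2 / K%:R) by rewrite mulr_ge0 ?divr_ge0 ?sqr_ge0.
  by apply: le_trans (ler_wpM2l rK Ki) _; rewrite mulr1.
have rK : 0 <= r ^+ 2 / K%:R by rewrite divr_ge0 ?sqr_ge0.
have h4 : (2^-1 + 2 / a) * (al k * beta) ^+ 2 <= 2^-1 * q ^+ 2 +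
    2 / (972 * 10 ^+ 2) * (4 * (r ^+ 2 / K%:R)).
  rewrite mulrDl; apply: lerD; first by apply: ler_wpM2l; [lra|exact: h2].
  apply: ler_pM; [lra|exact: sqr_ge0|lra|exact: le_trans h2 h3].
have h5 : r ^+ 2 / (800 * K%:R) = 1 / 800 * (r ^+ 2 / K%:R).
  by field; rewrite lt0r_neq0.
rewrite h5; lra.
Qed.

Lemma refined_potential_step : slow ->
  measurable_fun setT (fun w => refined k.+1 (next_y k y z (C w)) (next_z k z (C w))) ->
  (\int[P]_w (expR (s * refined k.+1 (next_y k y z (C w)) (next_z k z (C w))))%:E
    <= (expR (s * refined k y z))%:E)%E.
Proof.
move=> /slow_regime[l5 K780] mref.
pose t := progress k; pose tau := al k / A K; pose B := bias_mass.
have AKn : A K != 0 by rewrite lt0r_neq0.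
have eA : A k = t * A K by rewrite /t /progress divfK.
have eal : al k = tau * A K by rewrite /tau divfK.
have et' : progress k.+1 = t + tau by rewrite /progress AS' mulrDl.
have t0 : 0 <= t by rewrite /t /progress divr_ge0// ltW.
have tau0 : 0 <= tau by rewrite /tau divr_ge0// ltW.
have t1 : t + tau <= 1.
  rewrite -et' /progress ler_pdivrMr// mul1r.
  exact: (A_mono K_gt0 delta_gt0 delta_le1 L_gt0 a_big kK).
have tauK : tau * K%:R <= 2.
  rewrite /tau mulrAC ler_pdivrMr//.
  exact: (alpha_le_A K_gt0 delta_gt0 delta_le1 L_gt0 a_big kK).
have tau_le : tau <= 1 / 390.
  have : tau * 780 <= tau * K%:R by apply: ler_wpM2l.
  by lra.
have B0 : 0 <= B by rewrite /B /bias_mass divr_ge0 ?mulr_ge0// ltW.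
have B1 : B <= 15 / 16.
  rewrite /B /bias_mass ler_pdivrMr//.
  exact: (A_b_le K_gt0 delta_gt0 delta_le1 L_gt0 r_gt0 b_ge0 a_big).
have eb : al k * b = tau * (B * r).
  by rewrite /tau /B /bias_mass; field; rewrite AKn lt0r_neq0.
pose Z := z - xs; pose Y := t *: (y - xs).
have Z2 : enorm Z <= 2 * r by exact: le_trans z_ball rk.
have Yt : enorm Y <= t * (2 * r).
  by rewrite /Y enormZ ger0_norm// ler_wpM2l// (le_trans y_ball).
have Y2 : enorm Y <= 2 * r.
  by apply: le_trans Yt _; apply: ler_piMl; [have := r_gt0; lra | lra].
pose U := (3 - t - tau) / 2 *: Z - 2^-1 *: Y.
have U3 : enorm U <= 3 * r.
  have n1 : 0 <= (3 - t - tau) / 2 by lra.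
  apply: le_trans (enormB _ _) _; rewrite (enormZ _ Z) (enormZ _ Y) (ger0_norm n1) ger0_norm ?invr_ge0//.
  have : (3 - t - tau) / 2 * enorm Z <= (3 - t - tau) / 2 * (2 * r).
    by apply: ler_wpM2l => //; lra.
  have : 0 <= tau * r by rewrite mulr_ge0// ltW.
  by move: Yt; lra.
pose mu := (3 - t - tau) / 2 * (2^-1 + 2 / a).
have ai : a^-1 <= 1 / 100.
  rewrite div1r; have c0 : 0 < 100 :> R by [].
  by rewrite lef_pV2 ?posrE; [have := a_large; lra | exact: a0 | exact: c0].
have ai0 : 0 < a^-1 by rewrite invr_gt0.
have mu0 : 0 <= mu by apply: mulr_ge0; lra.
have mu1 : mu <= 1.
  apply: (@le_trans _ _ (3 / 2 * (2^-1 + 2 / 100))); last by lra.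
  by apply: ler_pM; lra.
pose val := 2 + 2 * (1 - t) ^+ 2.
(* Here - tau B r |U| cancels the bias al b |U|; 8/100 tau covers the 4/100 of [refined_drift] and
   the quadrature error of [h6], and the final term covers the slack, the squared bias and the
   variance. *)
pose c := tau * (r ^+ 2 * (B ^+ 2 / 4 * val + 4 / 100) - B * r * enorm U)
  - r ^+ 2 * (B ^+ 2 / 4 * (profile (t + tau) - profile t) + 8 / 100 * tau)
  - 2 / 100 * (r ^+ 2 / K%:R).
have Kn : K%:R != 0 :> R by rewrite lt0r_neq0.
apply: (@exp_step _ _ c mu U).
- exact: mref.
- exact: mu0.
- exact: mu1.
- exact: U3.
- move=> w; have Cw := C_small w.
  have dsc := next_descent Cw erefl; have cy := convex_y; have cx := convex_xs.
  have := A_big; have t1' := t1.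
  move: dsc cy cx; rewrite /g /x /next_y /query AS' => dsc cy cx Ab.
  have := refined_step (al0 k) (A0 k) a4 Ab dsc cy cx AKgt0 eA eal t1.
  rewrite -AS' -/(next_z k z (C w)) -/(next_y k y z (C w)) -/(query k y z) -/Z -/Y.
  rewrite -/x -/g -/U -/mu => step.
  have zd : enorm ((next_z k z (C w) - xs) - Z) <= r / 150.
    have -> : (next_z k z (C w) - xs) - Z = next_z k z (C w) - z.
      by rewrite /Z opprB addrA subrK.
    apply: le_trans (next_z_dist Cw) _; apply: ler_wpM2l; first exact: ltW.
    rewrite lef_pV2 ?posrE; [lra|by rewrite mulr_gt0|by []].
  have drift := refined_drift r_gt0 t0 tau0 t1 tau_le B0 B1 Z2 Y2 zd.
  have drift2 := ler_wpM2l tau0 drift.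
  rewrite -/val -/U in drift2.
  rewrite /refined et' -/B -/t -/Z -/Y.
  have -> : (K%:R - k.+1%:R) / K%:R * (2 / 100 * r ^+ 2) =
      (K%:R - k%:R) / K%:R * (2 / 100 * r ^+ 2) - 2 / 100 * (r ^+ 2 / K%:R).
    by rewrite -(natr1 k); field; rewrite Kn.
  by move: step drift2; rewrite /c; lra.
have q0 : 0 <= al k * b + slack by rewrite addr_ge0// mulr_ge0// ltW.
have rK : 0 <= r ^+ 2 / K%:R by rewrite divr_ge0 ?sqr_ge0.
have ab0 : 0 <= al k * beta by rewrite mulr_ge0// ltW.
have h1 : al k * beta * enorm U <= tau * (B * r) * enorm U + 3 / 1000 * (r ^+ 2 / K%:R).
  apply: le_trans (ler_wpM2r (enorm_ge0 U) al_beta) _.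
  rewrite eb mulrDl lerD2l.
  apply: (@le_trans _ _ (r / K%:R / 1000 * (3 * r))).
    apply: ler_pM => //; [exact: enorm_ge0 | exact: bias_slack_le].
  by rewrite le_eqVlt; apply/orP; left; apply/eqP; field; rewrite Kn.
have h2 : mu * (al k * beta) ^+ 2 <= 4 / 780 * (r ^+ 2 / K%:R).
  apply: le_trans (ler_piMl (sqr_ge0 _) mu1) _.
  have h : (al k * beta) ^+ 2 <= (2 * r / K%:R) ^+ 2.
    have bb : al k * beta <= 2 * r / K%:R by exact: le_trans al_b_K.
    by rewrite ler_sqr ?nnegrE; [exact: bb|exact: ab0|exact: le_trans bb].
  apply: le_trans h _.
  have -> : (2 * r / K%:R) ^+ 2 = 4 * K%:R^-1 * (r ^+ 2 / K%:R).
    by field; rewrite Kn.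
  apply: ler_wpM2r => //.
  have Ki : K%:R^-1 <= 780^-1 :> R.
    by rewrite lef_pV2 ?posrE; [exact: K780|exact: Kpos|lra].
  by lra.
have h5 : r ^+ 2 / (800 * K%:R) = 1 / 800 * (r ^+ 2 / K%:R).
  by field; rewrite Kn.
(* A left-endpoint rectangle against the integral of the decreasing weight. *)
have prof : tau * val - (profile (t + tau) - profile t) <= 2 * tau ^+ 2.
  have t3 : 0 <= tau ^+ 2 * tau by rewrite mulr_ge0 ?sqr_ge0.
  have t4 : 0 <= t * tau ^+ 2 by rewrite mulr_ge0 ?sqr_ge0.
  by rewrite /val /profile; lra.
have h6 : r ^+ 2 * (B ^+ 2 / 4) * (tau * val - (profile (t + tau) - profile t)) <=
    1 / 390 * (r ^+ 2 * tau).
  have BB : B ^+ 2 <= 1.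
    rewrite -(expr1n _ 2) ler_sqr ?nnegrE; [lra|exact: B0|exact: ler01].
  have rB : 0 <= r ^+ 2 * (B ^+ 2 / 4) by rewrite mulr_ge0 ?divr_ge0 ?sqr_ge0.
  apply: le_trans (ler_wpM2l rB prof) _.
  have -> : r ^+ 2 * (B ^+ 2 / 4) * (2 * tau ^+ 2) = (B ^+ 2 / 2 * tau) * (r ^+ 2 * tau) by field.
  apply: ler_wpM2r; first by rewrite mulr_ge0 ?sqr_ge0.
  have : B ^+ 2 / 2 * tau <= 1 / 2 * tau by apply: ler_wpM2r => //; lra.
  by lra.
have rt : 0 <= r ^+ 2 * tau by rewrite mulr_ge0 ?sqr_ge0.
by rewrite h5 /c; lra.
Qed.

End Estimator.

End Good.

Let s := 20 * l / r ^+ 2.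
Let s_gt0 : 0 < s.
Proof.
by apply: divr_gt0; [apply: mulr_gt0 => //; exact: lt_le_trans l1 | exact: exprn_gt0].
Qed.

(** A sum, so that a value below 1 makes both potentials negative with a single stopping time; each
    exponential starts below delta / 4. *)
Definition supermartingale k (y z : 'rV[R]_d) :=
  expR (s * potential k y z) + (if `[< slow >] then expR (s * refined k y z) else 0).

Lemma supermartingale_ge0 k y z : 0 <= supermartingale k y z.
Proof. by rewrite addr_ge0 ?expR_ge0//; case: ifP; rewrite ?expR_ge0. Qed.

Lemma supermartingale_lt1 k y z : supermartingale k y z < 1 ->
  potential k y z < 0 /\ (slow -> refined k y z < 0).
Proof.
have neg u : expR (s * u) < 1 -> u < 0 by rewrite expR_lt1 pmulr_rlt0.
rewrite /supermartingale => h; split.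
  apply: neg; apply: le_lt_trans h; rewrite lerDl.
  by case: ifP; rewrite ?expR_ge0.
move=> sl; apply: neg; move: h; rewrite asboolT// => h.
by apply: le_lt_trans h; rewrite lerDr expR_ge0.
Qed.

Lemma supermartingale_start x0 : enorm (x0 - xs) <= r ->
  supermartingale 0 x0 x0 <= delta / 2.
Proof.
move=> x0r; have D1 := dot_le_sqr x0r.
have start u : u <= - (1 / 20) * r ^+ 2 -> expR (s * u) <= delta / 4.
  move=> ur; apply: le_trans (expRN_log K_gt0 delta_gt0 delta_le1).
  rewrite ler_expR -/l.
  have -> : - l = s * (- (1 / 20) * r ^+ 2) by rewrite /s; field; rewrite lt0r_neq0.
  by apply: ler_wpM2l => //; exact: ltW.
have A00 : A 0 = 0 by rewrite /A /sstm_A big_nat1.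
have Kn : K%:R != 0 :> R by rewrite lt0r_neq0// ltr0n.
have r2 := sqr_ge0 r.
have e1 : (K%:R - 0%:R) / K%:R = 1 :> R by rewrite mulr0n subr0 divff.
have h1 : expR (s * potential 0 x0 x0) <= delta / 4.
  apply: start; rewrite /potential /energy /radius A00 e1 mulr0n !mul0r; lra.
have h2 : expR (s * refined 0 x0 x0) <= delta / 4.
  apply: start; rewrite /refined /refined_potential /progress /profile A00 e1 !mul0r.
  rewrite scale0r !(dotC _ 0) !dot0l; lra.
by rewrite /supermartingale; case: ifP => _; have := delta_gt0; lra.
Qed.

Lemma supermartingale_final y z : supermartingale K y z < 1 ->
  f y - f xs <= 6 * a * L * r ^+ 2 / (K * K.+3)%:R.
Proof.
move=> /supermartingale_lt1[pot ref].
suff F : A K * (f y - f xs) <= 3 / 2 * r ^+ 2.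
  have -> : 6 * a * L * r ^+ 2 / (K * K.+3)%:R = 3 / 2 * r ^+ 2 / A K.
    rewrite /A (AE K_gt0 delta_gt0 delta_le1 L_gt0 a_big) natrM.
    rewrite -(natr1 K.+2) -(natr1 K.+1) -(natr1 K).
    have -> : K%:R + 1 + 1 + 1 = K%:R + 3 :> R by ring.
    have K0 : 0 < K%:R :> R by rewrite ltr0n.
    by field; rewrite !lt0r_neq0// ltr_wpDl.
  by rewrite ler_pdivlMr// mulrC.
have [|nsl] := pselect slow; last first.
  have [_ h] := potential_bound (leqnn K) pot.
  by apply: le_trans h _; move/negP: nsl; rewrite -leNgt; lra.
move=> sl; have := ref sl; rewrite /refined /refined_potential.
have -> : progress K = 1 by rewrite /progress divff// lt0r_neq0.
rewrite scale1r subrr !mul0r addr0 /profile.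
have := dotvv_ge0 ((z - xs) - 2^-1 *: (y - xs)).
move: (z - xs) (y - xs) => Z Y; rewrite !dotE (dotC Y Z) => h.
have B1 : bias_mass ^+ 2 <= (15 / 16) ^+ 2.
  rewrite ler_sqr ?nnegrE.
  - rewrite /bias_mass ler_pdivrMr//.
    exact: (A_b_le K_gt0 delta_gt0 delta_le1 L_gt0 r_gt0 b_ge0 a_big).
  - by rewrite /bias_mass divr_ge0 ?mulr_ge0// ltW.
  - by lra.
have rB : r ^+ 2 * bias_mass ^+ 2 <= r ^+ 2 * (15 / 16) ^+ 2.
  by apply: ler_wpM2l => //; exact: sqr_ge0.
by have := sqr_ge0 r; lra.
Qed.

Section Measurability.
Hypothesis f_measurable : measurable_fun setT (f : borel R 1 d -> R).
Context {dX : measure_display} {Om : measurableType dX}.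
Variables (y z : Om -> 'rV[R]_d).
Hypothesis my : forall i, measurable_fun setT (fun w => y w 0 i).
Hypothesis mz : forall i, measurable_fun setT (fun w => z w 0 i).

Let mfy : measurable_fun setT (fun w => f (y w)).
Proof.
apply: (measurableT_comp f_measurable); apply: measurable_borel_mx => i j.
by rewrite ord1.
Qed.

Lemma measurable_potential k : measurable_fun setT (fun w => potential k (y w) (z w)).
Proof.
apply: measurable_funD => //; apply: measurable_funB => //.
apply: measurable_funD; apply: measurable_funM => //; first exact: measurable_funB.
by apply: measurable_dot => i; exact: measurable_coordB.
Qed.

Lemma measurable_refined k : measurable_fun setT (fun w => refined k (y w) (z w)).
Proof.
have mY i : measurable_fun setT (fun w => (progress k *: (y w - xs)) 0 i).
  have -> : (fun w => (progress k *: (y w - xs)) 0 i) =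
      (fun w => progress k * (y w - xs) 0 i).
    by apply/funext => w; rewrite mxE.
  by apply: measurable_funM => //; exact: measurable_coordB.
have mZ i : measurable_fun setT (fun w => (z w - xs) 0 i).
  exact: measurable_coordB.
apply: measurable_funD => //; apply: measurable_funB => //.
apply: measurable_funD; last first.
  by apply: measurable_funM => //; exact: measurable_dot.
apply: measurable_funB; last first.
  by apply: measurable_funM => //; exact: measurable_dot.
apply: measurable_funD; apply: measurable_funM => //; last exact: measurable_dot.
by apply: measurable_funM => //; exact: measurable_funB.
Qed.

Lemma measurable_supermartingale k :
  measurable_fun setT (fun w => supermartingale k (y w) (z w)).
Proof.
have mE (h : Om -> R) : measurable_fun setT h ->
    measurable_fun setT (fun w => expR (s * h w)).
  by move=> mh; apply: measurableT_comp => //; exact: measurable_funM.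
apply: measurable_funD; first by apply: mE; exact: measurable_potential.
by case: asboolP => // _; apply: mE; exact: measurable_refined.
Qed.

End Measurability.

Lemma supermartingale_step (dT : measure_display) (T : measurableType dT)
    (P : probability T R) (k : nat) (y z : 'rV[R]_d) (X : T -> 'rV[R]_d) :
  measurable_fun setT (f : borel R 1 d -> R) ->
  (k < K)%N -> supermartingale k y z < 1 -> enorm (y - xs) <= radius k ->
  bias_var_bounded P X (grad f (query k y z)) b sig ->
  (\int[P]_w (supermartingale k.+1 (next_y k y z (clip (X w) (lam k)))
      (next_z k z (clip (X w) (lam k))))%:E <= (supermartingale k y z)%:E)%E.
Proof.
move=> fm kK /supermartingale_lt1[pot _] yb bv.
have mC i : measurable_fun setT (fun w => clip (X w) (lam k) 0 i).
  apply: measurable_clip => j; have [h _ _] := bv.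
  by apply: (@summable_measurable _ _ _ P); exact: h.
have mz i : measurable_fun setT (fun w => next_z k z (clip (X w) (lam k)) 0 i).
  have -> : (fun w => next_z k z (clip (X w) (lam k)) 0 i) =
      (fun w => z 0 i - al k * clip (X w) (lam k) 0 i).
    by apply/funext => w; rewrite /next_z; move: (clip _ _) => c; rewrite !mxE.
  by apply: measurable_funB => //; exact: measurable_funM.
have my i : measurable_fun setT (fun w => next_y k y z (clip (X w) (lam k)) 0 i).
  have -> : (fun w => next_y k y z (clip (X w) (lam k)) 0 i) =
      (fun w => (A k.+1)^-1 * (A k * y 0 i + al k * next_z k z (clip (X w) (lam k)) 0 i)).
    by apply/funext => w; rewrite /next_y; move: (next_z _ _ _) => c; rewrite !mxE.
  by apply: measurable_funM => //; apply: measurable_funD => //; exact: measurable_funM.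
have mp := measurable_potential fm my mz k.+1.
have mr := measurable_refined fm my mz k.+1.
have mE (h : T -> R) : measurable_fun setT h ->
    measurable_fun setT (fun w => (expR (s * h w))%:E).
  by move=> mh; apply/measurable_EFinP; apply: measurableT_comp => //; exact: measurable_funM.
rewrite /supermartingale; case: asboolP => sl.
  under eq_integral do rewrite EFinD.
  rewrite ge0_integralD//; [|exact: mE mp|exact: mE mr].
  rewrite EFinD; apply: leeD.
    exact: (potential_step kK pot yb bv mp).
  exact: (refined_potential_step kK pot yb bv sl mr).
under eq_integral do rewrite addr0.
by rewrite addr0; exact: (potential_step kK pot yb bv mp).
Qed.

End OneStep.

Lemma bias_var_bounded_le (dT : measure_display) (T : measurableType dT)
    (R : realType) (P : probability T R) (n : nat) (X : T -> 'rV[R]_n)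
    (g : 'rV[R]_n) (b b' s s' : R) : 0 <= s -> b <= b' -> s <= s' ->
  bias_var_bounded P X g b s -> bias_var_bounded P X g b' s'.
Proof.
move=> s0 bb ss [h1 h2 h3]; split => //; first exact: le_trans bb.
by apply: le_trans h3 _; rewrite lee_fin ler_sqr ?nnegrE// (le_trans s0).
Qed.

Lemma differentiable_measurable (R : realType) (d : nat) (f : 'rV[R]_d -> R) :
  (forall x : 'rV[R]_d, differentiable f x) ->
  measurable_fun setT (f : borel R 1 d -> R).
Proof.
move=> df; apply: (measurability _ (measurable_realfun.RGenOpens.measurableE R)).
move=> _ [_ [p [q ->] <-]]; rewrite setTI; apply: sub_sigma_algebra.
have cf : continuous f by move=> x; exact: differentiable_continuous.
by move/continuousP: cf; apply; exact: interval_open.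
Qed.

Lemma measurable_sublevel (R : realType) (dX : measure_display)
    (X : measurableType dX) (u : X -> R) (c : R) :
  measurable_fun setT u -> measurable [set x | u x <= c].
Proof.
move=> mu; have := measurable_fun_ler mu (measurable_cst c).
move=> /(_ measurableT [set true] I); rewrite setTI.
by congr measurable; apply/seteqP; split => x /=; case: (u x <= c).
Qed.

(** * Measurability of the run in the oracle samples *)

Section RunMeasurability.
Context {R : realType} {d : nat} {dZ : measure_display} {Z : measurableType dZ}.
Variables (oracle : Z -> 'rV[R]_d -> 'rV[R]_d) (N : nat -> nat).
Variables (rule : forall k, 'M[R]_(N k, d) -> 'rV[R]_d) (K : nat).
Hypothesis oracle_measurable : measurable_fun setT
  (fun p : Z * borel R 1 d => oracle p.1 p.2 : borel R 1 d).
Hypothesis rule_measurable : forall k, (k <= K)%N ->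
  measurable_fun setT (@rule k : borel R (N k) d -> borel R 1 d).
Context {dX : measure_display} {Om : measurableType dX}.
Variables (xi : forall k, 'I_(N k) -> Om -> Z).
Variables (a L : R) (lam : nat -> R) (x0 : 'rV[R]_d).

Let est w k := aggregate (@rule k) oracle (fun j => xi j w).

Lemma measurable_aggregate k (q : Om -> 'rV[R]_d) : (k <= K)%N ->
  (forall j : 'I_(N k), measurable_fun setT (xi j)) ->
  (forall i, measurable_fun setT (fun w => q w 0 i)) ->
  forall i, measurable_fun setT (fun w => est w k (q w) 0 i).
Proof.
move=> kK mxi mq i.
have mq' : measurable_fun setT (q : Om -> borel R 1 d).
  by apply: measurable_borel_mx => i0 j; rewrite ord1.
have mo (j : 'I_(N k)) : measurable_fun setT
    (fun w => oracle (xi j w) (q w) : borel R 1 d).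
  exact: (measurableT_comp oracle_measurable (measurable_fun_pair (mxi j) mq')).
have mM : measurable_fun setT
    (fun w => \matrix_(j < N k) oracle (xi j w) (q w) : borel R (N k) d).
  apply: measurable_borel_mx => j i'.
  have -> : (fun w => (\matrix_(j0 < N k) oracle (xi j0 w) (q w)) j i') =
      (fun w => oracle (xi j w) (q w) 0 i').
    by apply/funext => w; rewrite mxE.
  exact: (measurableT_comp (@measurable_borel_coord R 1 d 0 i') (mo j)).
have mr := measurableT_comp (rule_measurable kK) mM.
exact: (measurableT_comp (@measurable_borel_coord R 1 d 0 i) mr).
Qed.

Lemma measurable_query k (y z : Om -> 'rV[R]_d) :
  (forall i, measurable_fun setT (fun w => y w 0 i)) ->
  (forall i, measurable_fun setT (fun w => z w 0 i)) ->
  forall i, measurable_fun setT (fun w => query L a k (y w) (z w) 0 i).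
Proof.
move=> my mz i.
have -> : (fun w => query L a k (y w) (z w) 0 i) = (fun w => (sstm_A a L k.+1)^-1 *
    (sstm_A a L k * y w 0 i + sstm_alpha a L k.+1 * z w 0 i)).
  by apply/funext => w; rewrite /query !mxE.
by apply: measurable_funM => //; apply: measurable_funD; exact: measurable_funM.
Qed.

Lemma measurable_next_z k (z C : Om -> 'rV[R]_d) :
  (forall i, measurable_fun setT (fun w => z w 0 i)) ->
  (forall i, measurable_fun setT (fun w => C w 0 i)) ->
  forall i, measurable_fun setT (fun w => next_z L a k (z w) (C w) 0 i).
Proof.
move=> mz mC i.
have -> : (fun w => next_z L a k (z w) (C w) 0 i) =
    (fun w => z w 0 i - sstm_alpha a L k.+1 * C w 0 i).
  by apply/funext => w; rewrite /next_z !mxE.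
by apply: measurable_funB => //; exact: measurable_funM.
Qed.

Lemma measurable_next_y k (y z C : Om -> 'rV[R]_d) :
  (forall i, measurable_fun setT (fun w => y w 0 i)) ->
  (forall i, measurable_fun setT (fun w => z w 0 i)) ->
  (forall i, measurable_fun setT (fun w => C w 0 i)) ->
  forall i, measurable_fun setT (fun w => next_y L a k (y w) (z w) (C w) 0 i).
Proof.
move=> my mz mC; exact: (measurable_query (z := fun w => next_z L a k (z w) (C w))
  k my (measurable_next_z k mz mC)).
Qed.

Let X w := sstm_x a L lam (est w) x0.
Let Y w := sstm_y a L lam (est w) x0.
Let W w := sstm_z a L lam (est w) x0.

(** The space [Om] is kept abstract so that the run can be read on T with its own sigma-algebra and
    on T with that of the past; the state after n iterations depends on the samples of the
    iterations before n. *)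
Lemma measurable_run n : (n <= K.+1)%N ->
  (forall k (j : 'I_(N k)), (k < n)%N -> measurable_fun setT (xi j)) ->
  [/\ forall i, measurable_fun setT (fun w => X w n 0 i),
      forall i, measurable_fun setT (fun w => Y w n 0 i) &
      forall i, measurable_fun setT (fun w => W w n 0 i)].
Proof.
elim: n => [|n ih] nK mxi; first by split => i; exact: measurable_cst.
have [] := ih (ltnW nK).
  by move=> k j kn; apply: mxi; exact: ltnW.
move=> _ my mz.
have mq := measurable_query n my mz.
have mg := measurable_aggregate nK (fun j => mxi n j (ltnSn n)) mq.
have mC i := measurable_clip (lam n) i mg.
have eX : (fun w => X w n.+1) = (fun w => query L a n (Y w n) (W w n)).
  by apply/funext => w; rewrite /X /sstm_x /Y /W /sstm_y /sstm_z /=; case: sstm => [[]].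
have eW : (fun w => W w n.+1) = (fun w => next_z L a n (W w n)
    (clip (est w n (query L a n (Y w n) (W w n))) (lam n))).
  by apply/funext => w; rewrite /Y /W /sstm_y /sstm_z /=; case: sstm => [[]].
have eY : (fun w => Y w n.+1) = (fun w => next_y L a n (Y w n) (W w n)
    (clip (est w n (query L a n (Y w n) (W w n))) (lam n))).
  by apply/funext => w; rewrite /Y /W /sstm_y /sstm_z /=; case: sstm => [[]].
have cE (F : Om -> nat -> 'rV[R]_d) G : (fun w => F w n.+1) = G ->
    forall i, (fun w => F w n.+1 0 i) = (fun w => G w 0 i).
  by move=> <- i.
split => i.
- by rewrite (cE _ _ eX); exact: mq.
- by rewrite (cE _ _ eY); exact: measurable_next_y.
- by rewrite (cE _ _ eW); exact: measurable_next_z.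
Qed.

End RunMeasurability.

(** * The high-probability statement *)

Section HighProbability.
Context {R : realType} {d : nat}.
Variables (f : 'rV[R]_d -> R) (xs x0 : 'rV[R]_d).
Variables (K : nat) (delta L r b sig a : R).
Hypothesis f_diff : forall x : 'rV[R]_d, differentiable f x.
Hypothesis xs_min : forall x, f xs <= f x.
Hypothesis smooth : forall x y, eball xs (3 * r) x -> eball xs (3 * r) y ->
  enorm (grad f x - grad f y) <= L * enorm (x - y).
Hypothesis grad_bound : forall x, eball xs (3 * r) x ->
  enorm (grad f x) ^+ 2 <= 2 * L * (f x - inf [set f u | u in eball xs (3 * r)]).
Hypothesis convex : forall x y, eball xs (3 * r) x -> eball xs (3 * r) y ->
  f x + dot (grad f x) (y - x) <= f y.
Hypotheses (K_gt0 : (0 < K)%N) (delta_gt0 : 0 < delta) (delta_le1 : delta <= 1).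
Hypotheses (L_gt0 : 0 < L) (r_gt0 : 0 < r) (b_ge0 : 0 <= b) (sig_ge0 : 0 <= sig).
Hypothesis a_big : sstm_a_min K delta L r b sig <= a.
Hypothesis x0_ball : enorm (x0 - xs) <= r.
Context {dT : measure_display} {T : measurableType dT} {P : probability T R}.
Context {dZ : measure_display} {Z : measurableType dZ}.
Variables (oracle : Z -> 'rV[R]_d -> 'rV[R]_d) (N : nat -> nat).
Variables (rule : forall k, 'M[R]_(N k, d) -> 'rV[R]_d).
Hypothesis oracle_measurable : measurable_fun setT
  (fun p : Z * borel R 1 d => oracle p.1 p.2 : borel R 1 d).
Hypothesis rule_measurable : forall k, (k <= K)%N ->
  measurable_fun setT (@rule k : borel R (N k) d -> borel R 1 d).
Variable xi : forall k, 'I_(N k) -> {RV P >-> Z}.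
Hypothesis xi_indep : mutually_independent
  (fun i : {k : 'I_K.+1 & 'I_(N k)} => xi (tagged i)).
Let lam := sstm_lambda a L K delta r.
Let est w k := aggregate (@rule k) oracle (fun j => xi j w).
Hypothesis est_bv : forall k, (k <= K)%N -> forall x,
  bias_var_bounded P (fun w => est w k x) (grad f x) b sig.
Let x w := sstm_x a L lam (est w) x0.
Let y w := sstm_y a L lam (est w) x0.
Let z w := sstm_z a L lam (est w) x0.

Let I := {k : 'I_K.+1 & 'I_(N k)}.
Let noise (i : I) := xi (tagged i).
Let past k : {set I} := [set i : I | (tag i < k)%N]%SET.
Let current k : {set I} := [set i : I | (tag i : nat) == k]%SET.

Let past_current k : [disjoint past k & current k]%B.
Proof.
rewrite disjoint_subset; apply/fintype.subsetP => i.
by rewrite !finset.inE => ik; rewrite neq_ltn ik.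
Qed.

Let f_measurable := differentiable_measurable f_diff.

Let m k w := supermartingale f xs K delta L r b a k (y w k) (z w k).

Let run_measurable n : (n <= K.+1)%N ->
  [/\ forall i, measurable_fun setT (fun w => x w n 0 i),
      forall i, measurable_fun setT (fun w => y w n 0 i) &
      forall i, measurable_fun setT (fun w => z w n 0 i)].
Proof.
by move=> nK; apply: (measurable_run oracle_measurable rule_measurable).
Qed.

Let noise_measurable (J : {set I}) k (j : 'I_(N k)) (kK : (k < K.+1)%N) :
  (Tagged (fun k : 'I_K.+1 => 'I_(N k)) (j : 'I_(N (Ordinal kK)))) \in J ->
  measurable_fun setT (xi j : g_sigma_algebraType (cylinder noise J) -> Z).
Proof. exact: cylinder_coord. Qed.

Let run_past_measurable n k : (n <= k)%N -> (k <= K)%N ->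
  [/\ forall i, measurable_fun setT
        (fun w : g_sigma_algebraType (cylinder noise (past k)) => x w n 0 i),
      forall i, measurable_fun setT
        (fun w : g_sigma_algebraType (cylinder noise (past k)) => y w n 0 i) &
      forall i, measurable_fun setT
        (fun w : g_sigma_algebraType (cylinder noise (past k)) => z w n 0 i)].
Proof.
move=> nk kK.
apply: (measurable_run (Om := g_sigma_algebraType (cylinder noise (past k)))
  oracle_measurable rule_measurable).
  exact: leq_trans nk (leqW kK).
move=> k' j k'n; have k'K : (k' < K.+1)%N.
  by rewrite ltnS; apply: leq_trans kK; apply: leq_trans nk; exact: ltnW.
apply: (@noise_measurable _ _ j k'K); rewrite finset.inE /=.
exact: leq_trans nk.
Qed.

Let m_measurable k : (k <= K)%N -> measurable_fun setT (m k).
Proof.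
move=> kK; have [_ my mz] := run_measurable (leqW kK).
exact: measurable_supermartingale.
Qed.

Let y_step w k : y w k.+1 = next_y L a k (y w k) (z w k)
  (clip (est w k (query L a k (y w k) (z w k))) (lam k)).
Proof. by rewrite /y /z /sstm_y /sstm_z /=; case: sstm => [[]]. Qed.

Let z_step w k : z w k.+1 = next_z L a k (z w k)
  (clip (est w k (query L a k (y w k) (z w k))) (lam k)).
Proof. by rewrite /y /z /sstm_y /sstm_z /=; case: sstm => [[]]. Qed.

Let x_step w k : x w k.+1 = query L a k (y w k) (z w k).
Proof. by rewrite /x /sstm_x /y /z /sstm_y /sstm_z /=; case: sstm => [[]]. Qed.

Let rad := radius K L r b a.

(** The potential controls z^k directly; y^{k+1} is a convex combination of y^k and z^{k+1}, and the
    radii increase, so y follows by induction. *)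
Let alive_ball k w : (k <= K)%N -> alive m k w ->
  enorm (y w k - xs) <= rad k /\ enorm (z w k - xs) <= rad k.
Proof.
move=> kK /aliveP aw.
have zb j : (j <= k)%N -> enorm (z w j - xs) <= rad j.
  move=> jk; have [pot _] := supermartingale_lt1 K_gt0 delta_gt0 delta_le1 r_gt0 (aw j jk).
  by have [] := potential_bound xs_min K_gt0 delta_gt0 delta_le1 L_gt0 r_gt0 b_ge0
    a_big (leq_trans jk kK) pot.
split; last exact: zb.
elim: k kK aw zb => [|k ih] kK aw zb.
  apply: le_trans (radius_ge K_gt0 delta_gt0 delta_le1 L_gt0 r_gt0 b_ge0 a_big 0).
  exact: x0_ball.
have yk : enorm (y w k - xs) <= rad k.
  apply: ih; first exact: ltnW.
  - by move=> j jk; apply: aw; exact: leqW.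
  - by move=> j jk; apply: zb; exact: leqW.
have zk := zb _ (leqnn k.+1).
rewrite y_step /next_y AS -z_step; apply: eball_convex.
- exact: (A_ge0 K_gt0 delta_gt0 delta_le1 L_gt0 a_big).
- exact: ltW (alpha_gt0 K_gt0 delta_gt0 delta_le1 L_gt0 a_big k).
- apply: ltr_wpDl; first exact: (A_ge0 K_gt0 delta_gt0 delta_le1 L_gt0 a_big).
  exact: (alpha_gt0 K_gt0 delta_gt0 delta_le1 L_gt0 a_big).
- apply: le_trans yk _.
  exact: (radius_mono K_gt0 delta_gt0 delta_le1 L_gt0 r_gt0 b_ge0 a_big (leqnSn k)).
- exact: zk.
Qed.

Let m_step k : (k < K)%N ->
  (\int[P]_w (if alive m k w then m k.+1 w else 0)%:E <=
   \int[P]_w (if alive m k w then m k w else 0)%:E)%E.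
Proof.
move=> kK; have kK' := ltnW kK.
pose O1 := g_sigma_algebraType (cylinder noise (past k)).
pose O2 := g_sigma_algebraType (cylinder noise (current k)).
pose C (p : O1 * O2) :=
  clip (est p.2 k (query L a k (y p.1 k) (z p.1 k))) (lam k).
(* The state and the good event are read from [p.1], the samples of iteration k from [p.2]. With
   [p.1] fixed the query point is deterministic and the bias and variance bounds apply to it. *)
pose h (p : O1 * O2) : \bar R := (if alive m k p.1 then
  supermartingale f xs K delta L r b a k.+1 (next_y L a k (y p.1 k) (z p.1 k) (C p))
    (next_z L a k (z p.1 k) (C p)) else 0)%:E.
have -> : (\int[P]_w (if alive m k w then m k.+1 w else 0)%:E =
    \int[P]_w h (w, w))%E.
  by apply: eq_integral => w _; rewrite /h /m /C /= y_step z_step.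
have [_ my1 mz1] := run_past_measurable (leqnn k) kK'.
have my i : measurable_fun setT (fun p : O1 * O2 => y p.1 k 0 i).
  exact: (measurableT_comp (my1 i) measurable_fst).
have mz i : measurable_fun setT (fun p : O1 * O2 => z p.1 k 0 i).
  exact: (measurableT_comp (mz1 i) measurable_fst).
have mq := measurable_query a L k my mz.
have mxi (j : 'I_(N k)) : measurable_fun setT (fun p : O1 * O2 => xi j p.2).
  have jcur : (Tagged (fun k : 'I_K.+1 => 'I_(N k))
      (j : 'I_(N (Ordinal (leqW kK))))) \in current k by rewrite finset.inE /=.
  exact: (measurableT_comp (noise_measurable jcur) measurable_snd).
have mC i : measurable_fun setT (fun p => C p 0 i).
  have mg := measurable_aggregate oracle_measurable rule_measurable
    (xi := fun k0 (j : 'I_(N k0)) (p : O1 * O2) => xi j p.2) kK' mxi mq.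
  exact: (measurable_clip (lam k) i mg).
have malive : measurable_fun setT (alive m k : O1 -> bool).
  apply: measurable_alive => j jk.
  have [_ myj mzj] := run_past_measurable jk kK'.
  exact: measurable_supermartingale.
apply: (cylinder_decoupling_le xi_indep (past_current k)).
- apply/measurable_EFinP; apply: measurable_fun_ifT => //.
    exact: (measurableT_comp malive measurable_fst).
  apply: measurable_supermartingale => //; first exact: measurable_next_y.
  exact: measurable_next_z.
- move=> p; rewrite lee_fin; case: ifP => // _.
  exact: supermartingale_ge0.
- apply/measurable_EFinP; apply: measurable_alive_if => //.
    by move=> j jk; apply: m_measurable; exact: leq_trans kK'.
  exact: m_measurable.
move=> w; rewrite /h /C /=; case: ifP => [aw|_]; last by rewrite integral0.
have [yb _] := alive_ball kK' aw.
apply: (supermartingale_step xs_min smooth grad_bound convex K_gt0 delta_gt0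
  delta_le1 L_gt0 r_gt0 b_ge0 sig_ge0 a_big f_measurable kK _ yb (est_bv kK' _)).
by move/aliveP: aw => /(_ k (leqnn k)).
Qed.

(** The second claim concerns a larger event, whose measurability must be shown separately; c will
    be the asymptotic rate. *)
Theorem sstm_high_probability :
  with_prob_ge P (1 - delta) [set w |
    [/\ f (y w K) - f xs <= 6 * a * L * r ^+ 2 / (K * K.+3)%:R,
        (forall k, (k <= K.+1)%N -> eball xs (2 * r) (x w k)),
        (forall k, (k <= K)%N -> eball xs (2 * r) (z w k)) &
        (forall k, (k <= K)%N -> eball xs (2 * r) (y w k))]] /\
  (forall c, 6 * a * L * r ^+ 2 / (K * K.+3)%:R <= c ->
   with_prob_ge P (1 - delta) [set w | f (y w K) - f xs <= c]).
Proof.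
have [mbad Pbad] := @stopped_maximal_inequality _ _ _ P m K (delta / 2) m_measurable
  (fun k w => supermartingale_ge0 _ _ _ _ _ _ _ _ _ _ _)
  (fun w => supermartingale_start f L b a K_gt0 delta_gt0 delta_le1 r_gt0 x0_ball)
  m_step.
have mf c : measurable [set w | f (y w K) - f xs <= c].
  apply: measurable_sublevel; apply: measurable_funB => //.
  apply: (measurableT_comp f_measurable); apply: measurable_borel_mx => i j.
  by rewrite ord1; have [_ my _] := run_measurable (leqnSn K).
have mball (q : T -> 'rV[R]_d) : (forall i, measurable_fun setT (fun w => q w 0 i)) ->
    measurable [set w | eball xs (2 * r) (q w)].
  move=> mq; apply: measurable_sublevel; apply: measurable_enorm => i.
  exact: measurable_coordB.
have mballs n (q : T -> nat -> 'rV[R]_d) : (n <= K.+1)%N ->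
    (forall k, (k <= n)%N -> forall i, measurable_fun setT (fun w => q w k 0 i)) ->
    measurable [set w | forall k, (k <= n)%N -> eball xs (2 * r) (q w k)].
  move=> nK mq.
  rewrite [X in measurable X](_ : _ =
      \bigcap_(k in [set k | (k <= n)%N]) [set w | eball xs (2 * r) (q w k)]).
    by apply: bigcap_measurableType => k /= kn; apply: mball => i; exact: mq.
  by apply/seteqP; split => w h k; exact: h.
set c0 := 6 * a * L * r ^+ 2 / _; set E := [set w | _].
have mE : measurable E.
  rewrite [X in measurable X](_ : _ = ([set w | f (y w K) - f xs <= c0] `&`
      [set w | forall k, (k <= K.+1)%N -> eball xs (2 * r) (x w k)]) `&`
      ([set w | forall k, (k <= K)%N -> eball xs (2 * r) (z w k)] `&`
      [set w | forall k, (k <= K)%N -> eball xs (2 * r) (y w k)])).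
    apply: measurableI; apply: measurableI; first exact: mf.
    - by apply: mballs => // k kK i; have [] := run_measurable kK.
    - by apply: mballs => // k kK i; have [] := run_measurable (leqW kK).
    - by apply: mballs => // k kK i; have [] := run_measurable (leqW kK).
  apply/seteqP; split => [w [h1 h2 h3 h4]|w [[h1 h2] [h3 h4]]]; last by split.
  by split; split.
have goodE : ~` [set w | ~~ alive m K w] `<=` E.
  move=> w /= /negP; rewrite negbK => aw.
  have ball k : (k <= K)%N -> enorm (y w k - xs) <= rad k /\ enorm (z w k - xs) <= rad k.
    move=> kK; apply: alive_ball => //; apply/aliveP => j jk.
    by move/aliveP: aw => /(_ j (leq_trans jk kK)).
  have r2 k : (k <= K)%N -> rad k <= 2 * r.
    exact: (radius_le_2r K_gt0 delta_gt0 delta_le1 L_gt0 r_gt0 b_ge0 a_big).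
  split.
  - have mK : m K w < 1 by move/aliveP: aw => /(_ K (leqnn K)).
    exact: (supermartingale_final xs_min K_gt0 delta_gt0 delta_le1 L_gt0 r_gt0 b_ge0 a_big mK).
  - case=> [_|k kK].
      by rewrite /eball /=; apply: le_trans x0_ball _; have := r_gt0; lra.
    have [yk zk] := ball k kK.
    have alk := alpha_gt0 K_gt0 delta_gt0 delta_le1 L_gt0 a_big k.
    have Ak := A_ge0 K_gt0 delta_gt0 delta_le1 L_gt0 a_big k.
    rewrite x_step; apply: le_trans (r2 k kK); rewrite /query AS.
    by apply: eball_convex => //; [exact: ltW | exact: ltr_wpDl].
  - by move=> k kK; rewrite /eball /=; apply: le_trans (r2 k kK); have [] := ball k kK.
  - by move=> k kK; rewrite /eball /=; apply: le_trans (r2 k kK); have [] := ball k kK.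
have PE (G : set T) : measurable G -> ~` [set w | ~~ alive m K w] `<=` G ->
    with_prob_ge P (1 - delta) G.
  move=> mG hG; split => //.
  apply: (@le_trans _ _ (P (~` [set w | ~~ alive m K w]))); last first.
    by apply: le_measure; rewrite ?inE//; exact: measurableC.
  rewrite probability_setC// EFinB; apply: leeB => //.
  by apply: le_trans Pbad _; rewrite lee_fin; have := delta_gt0; lra.
split=> [|c hc]; apply: PE => // w /goodE[] // h _ _ _.
exact: le_trans hc.
Qed.

End HighProbability.

(** * Comparison with the asymptotic rate *)

Lemma rate_bound (R : realType) (rho : R) (K : nat) (delta L r b sig : R) :
  1 < rho -> (0 < K)%N -> 0 < delta -> 0 < L -> 0 < r -> 0 <= b -> 0 <= sig ->
  rho <= K%:R / delta ->
  6 * sstm_a_min K delta L r b sig * L * r ^+ 2 / (K * K.+3)%:R <=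
  6 * (972 * 10 ^+ 2) * (1 + ln 4 / ln rho) ^+ 2 * sstm_rate K delta L r b sig.
Proof.
move=> rho1 K_gt0 delta_gt0 L_gt0 r_gt0 b_ge0 sig_ge0 hrho.
have [q [q_gt0 q18 qE]] : exists q : R, [/\ 0 < q, 18 * 10 ^+ 2 <= q & 972 * 10 ^+ 2 = q].
  by eexists; split; [| |reflexivity]; lra.
have K1 : 1 <= K%:R :> R by rewrite ler1n.
have K0 : 0 < K%:R :> R by lra.
have Kd0 : 0 < K%:R / delta by rewrite divr_gt0.
have lr0 : 0 < ln rho by rewrite ln_gt0.
have ln40 : 0 <= ln 4 :> R by rewrite ln_ge0// ler1n.
rewrite /sstm_a_min qE.
set l' := ln (K%:R / delta); set l := ln (4 * K%:R / delta).
set c := 1 + ln 4 / ln rho.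
have l'rho : ln rho <= l' by rewrite ler_ln ?posrE// (lt_trans _ rho1).
have l'0 : 0 < l' by exact: lt_le_trans l'rho.
have lE : l = ln 4 + l' by rewrite /l -mulrA lnM ?posrE.
have c1 : 1 <= c by rewrite /c lerDl divr_ge0// ltW.
(* As l = ln 4 + l' and l' >= ln rho > 0, the summand ln 4 is at most (ln 4 / ln rho) l'. Without a
   lower bound above 1 on K / delta, l' could vanish. *)
have lc : l <= c * l'.
  rewrite lE /c mulrDl mul1r addrC lerD2l mulrAC ler_pdivlMr//.
  exact: ler_wpM2l.
have l0 : 0 <= l by rewrite lE addr_ge0// ltW.
have cc : c <= c ^+ 2 by rewrite expr2 ler_peMr// (le_trans ler01).
have c2 : 1 <= c ^+ 2 by exact: le_trans cc.
have lc2 : l <= c ^+ 2 * l'.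
  by apply: le_trans lc _; rewrite ler_wpM2r// ltW.
have sl : Num.sqrt l <= c * Num.sqrt l'.
  have -> : c = Num.sqrt (c ^+ 2) by rewrite sqrtr_sqr ger0_norm// (le_trans ler01).
  by rewrite -sqrtrM ?sqr_ge0// ler_wsqrtr.
set rate := sstm_rate K delta L r b sig.
have -> : (K * K.+3)%:R = K%:R * (K%:R + 3) :> R.
  by rewrite natrM -(natr1 K.+2) -(natr1 K.+1) -(natr1 K); congr (_ * _); ring.
rewrite ler_pdivrMr; last by rewrite mulr_gt0//; lra.
rewrite -!(mulrA 6) ler_pM2l// -(mulrA _ L) -ler_pdivlMr; last first.
  by rewrite mulr_gt0 ?exprn_gt0.
have rate_le u v : u <= q * c ^+ 2 * v * (K%:R * (K%:R + 3)) / (L * r ^+ 2) ->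
    v <= rate -> u <= q * c ^+ 2 * rate * (K%:R * (K%:R + 3)) / (L * r ^+ 2).
  move=> uv vr; apply: le_trans uv _.
  apply: ler_wpM2r; first by rewrite invr_ge0 mulr_ge0 ?sqr_ge0// ltW.
  apply: ler_wpM2r; first by rewrite mulr_ge0//; lra.
  by apply: ler_wpM2l => //; rewrite mulr_ge0 ?sqr_ge0// ltW.
have Kn := lt0r_neq0 K0; have Ln := lt0r_neq0 L_gt0; have rn := lt0r_neq0 r_gt0.
(* Each term of the maximum is compared with one branch of the rate; the quadratic bias term matches
   b R, the logarithmic one b R l' / K. As c >= 1, the factor c^2 serves all four. *)
rewrite !ge_max; apply/and4P; split.
- apply: (rate_le _ (L * r ^+ 2 * l' ^+ 2 / K%:R ^+ 2)); last by rewrite /rate /sstm_rate le_max lexx.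
  have -> : q * c ^+ 2 * (L * r ^+ 2 * l' ^+ 2 / K%:R ^+ 2) * (K%:R * (K%:R + 3)) /
      (L * r ^+ 2) = q * (c * l') ^+ 2 * ((K%:R + 3) / K%:R).
    by field; rewrite Kn Ln rn.
  have h : l ^+ 2 <= (c * l') ^+ 2 by rewrite ler_sqr ?nnegrE// (le_trans l0 lc).
  apply: le_trans (ler_wpM2l (ltW q_gt0) h) _.
  apply: ler_peMr; first exact: mulr_ge0 (ltW q_gt0) (sqr_ge0 _).
  by rewrite ler_pdivlMr//; lra.
- apply: (rate_le _ (sig * r * Num.sqrt l' / Num.sqrt K%:R)); last first.
    by rewrite /rate /sstm_rate !le_max lexx !orbT.
  have sK : 0 < Num.sqrt K%:R :> R by rewrite sqrtr_gt0.
  have sKE : K%:R = Num.sqrt K%:R * Num.sqrt K%:R :> R by rewrite -expr2 sqr_sqrtr// ltW.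
  have sKn := lt0r_neq0 sK.
  have -> : q * c ^+ 2 * (sig * r * Num.sqrt l' / Num.sqrt K%:R) * (K%:R * (K%:R + 3)) /
      (L * r ^+ 2) = (q * sig * (K%:R + 3) * Num.sqrt K%:R * (c ^+ 2 * Num.sqrt l')) / (L * r).
    rewrite [X in (X * (K%:R + 3))]sKE.
    by field; rewrite sKn Ln rn.
  apply: ler_wpM2r; first by rewrite invr_ge0 mulr_ge0// ltW.
  have s0 := sqrtr_ge0 l; have s0' := sqrtr_ge0 l'.
  apply: ler_pM => //.
  - by rewrite !mulr_ge0 ?ler0n ?(ltW sK)//; apply: exprn_ge0.
  - apply: ler_wpM2r; first exact: ltW.
    apply: ler_pM => //; first by rewrite !mulr_ge0//; apply: exprn_ge0.
      by apply: ler_wpM2r.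
    by rewrite -(natr1 K); lra.
  - by apply: le_trans sl _; apply: ler_wpM2r.
- apply: (rate_le _ (b * r)); last by rewrite /rate /sstm_rate !le_max lexx !orbT.
  have -> : q * c ^+ 2 * (b * r) * (K%:R * (K%:R + 3)) / (L * r ^+ 2) =
      (q * c ^+ 2 * 15 * (b * (K%:R * (K%:R + 3)))) / (15 * L * r).
    by field; rewrite Ln rn.
  apply: ler_wpM2r; first by rewrite invr_ge0 !mulr_ge0// ltW.
  have qc : 10 <= q * c ^+ 2 * 15.
    have : q * 1 <= q * c ^+ 2 by apply: ler_wpM2l => //; exact: ltW.
    by move: q18; lra.
  have h : 4 * b * K.+2%:R ^+ 2 <= 10 * (b * (K%:R * (K%:R + 3))).
    rewrite -(natr1 K.+1) -(natr1 K).
    have : b * (4 * (K%:R + 1 + 1) ^+ 2) <= b * (10 * (K%:R * (K%:R + 3))).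
      by apply: ler_wpM2l => //; nra.
    by lra.
  apply: le_trans h _; apply: ler_wpM2r => //.
  by rewrite !mulr_ge0//; lra.
- apply: (rate_le _ (b * r * l' / K%:R)); last by rewrite /rate /sstm_rate !le_max lexx !orbT.
  have -> : q * c ^+ 2 * (b * r * l' / K%:R) * (K%:R * (K%:R + 3)) / (L * r ^+ 2) =
      (q * (b * (K%:R + 3) * (c ^+ 2 * l'))) / (L * r).
    by field; rewrite Kn Ln rn.
  apply: ler_wpM2r; first by rewrite invr_ge0 mulr_ge0// ltW.
  rewrite -!mulrA; apply: ler_pM => //.
  - by rewrite !mulr_ge0.
  - by move: q18; lra.
  - apply: ler_wpM2l => //; apply: ler_pM => //.
    by rewrite -(natr1 K.+1) -(natr1 K); lra.
  by rewrite mulrA -expr2.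
Qed.

Theorem theoremC3 (R : realType) (rho : R) (hrho : 1 < rho) :
  exists C : R, 0 < C /\
  forall (d : nat) (f : 'rV[R]_d -> R) (xs x0 : 'rV[R]_d) (r L : R)
    (hf : forall x : 'rV[R]_d, differentiable f x)
    (hxs : forall x, f xs <= f x)
    (hr : 0 < r) (hx0 : enorm (x0 - xs) <= r) (hL : 0 < L)
    (hsmooth : forall x y, eball xs (3 * r) x -> eball xs (3 * r) y ->
       enorm (grad f x - grad f y) <= L * enorm (x - y))
    (hgrad : forall x, eball xs (3 * r) x ->
       enorm (grad f x) ^+ 2 <=
         2 * L * (f x - inf [set f u | u in eball xs (3 * r)]))
    (hconv : forall x y, eball xs (3 * r) x -> eball xs (3 * r) y ->
       f x + dot (grad f x) (y - x) <= f y)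
    (K : nat) (hK : (0 < K)%N)
    (delta : R) (hdelta0 : 0 < delta) (hdelta1 : delta <= 1)
    (dT : measure_display) (T : measurableType dT) (P : probability T R)
    (dZ : measure_display) (Z : measurableType dZ) (D : probability Z R)
    (oracle : Z -> 'rV[R]_d -> 'rV[R]_d)
    (horacle : measurable_fun setT
       (fun p : Z * borel R 1 d => oracle p.1 p.2 : borel R 1 d))
    (N : nat -> nat)
    (rule : forall k, 'M[R]_(N k, d) -> 'rV[R]_d)
    (hrule : forall k, (k <= K)%N ->
       measurable_fun setT (rule k : borel R (N k) d -> borel R 1 d))
    (xi : forall k, 'I_(N k) -> {RV P >-> Z})
    (hindep : mutually_independent
       (fun i : {k : 'I_K.+1 & 'I_(N k)} => xi (tag i) (tagged i)))
    (hdistr : forall k (j : 'I_(N k)), (k <= K)%N ->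
       forall A, measurable A -> distribution P (xi k j) A = D A)
    (b sigma : nat -> R)
    (hb : forall k, (k <= K)%N -> 0 <= b k)
    (hsigma : forall k, (k <= K)%N -> 0 <= sigma k)
    (hest : forall k, (k <= K)%N -> forall x,
       bias_var_bounded P
         (fun w => aggregate (rule k) oracle (fun j => xi k j w) x)
         (grad f x) (b k) (sigma k))
    (a : R),
  let bmax := \big[Num.max/0]_(k < K.+1) b k in
  let smax := \big[Num.max/0]_(k < K.+1) sigma k in
  let amin := sstm_a_min K delta L r bmax smax in
  let est := fun w k => aggregate (rule k) oracle (fun j => xi k j w) in
  let lam := sstm_lambda a L K delta r in
  let x := fun w => sstm_x a L lam (est w) x0 in
  let y := fun w => sstm_y a L lam (est w) x0 in
  let z := fun w => sstm_z a L lam (est w) x0 in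
  amin <= a ->
  with_prob_ge P (1 - delta) [set w |
    [/\ f (y w K) - f xs <= 6 * a * L * r ^+ 2 / (K * K.+3)%:R,
        (forall k, (k <= K.+1)%N -> eball xs (2 * r) (x w k)),
        (forall k, (k <= K)%N -> eball xs (2 * r) (z w k)) &
        (forall k, (k <= K)%N -> eball xs (2 * r) (y w k))]]
  /\
  (a = amin -> rho <= K%:R / delta ->
   with_prob_ge P (1 - delta) [set w |
     f (y w K) - f xs <= C * sstm_rate K delta L r bmax smax]).
Proof.
have ln4 : 0 <= ln 4 / ln rho by rewrite divr_ge0 ?ln_ge0 ?ler1n// ltW// ltW.
exists (6 * (972 * 10 ^+ 2) * (1 + ln 4 / ln rho) ^+ 2); split.
  have c2 : 0 < (1 + ln 4 / ln rho) ^+ 2 by rewrite exprn_gt0//; lra.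
  by apply: mulr_gt0 c2; lra.
move=> d f xs x0 r L hf hxs hr hx0 hL hsmooth hgrad hconv K hK delta hdelta0 hdelta1.
move=> dT T P dZ Z D oracle horacle N rule hrule xi hindep _ b sigma hb hsigma hest a.
move=> bmax smax amin est lam x y z ha.
(* Starting the maximum at 0 does not change it, since the b k are nonnegative. *)
have bmax0 : 0 <= bmax by exact: bigmax_ge_id.
have smax0 : 0 <= smax by exact: bigmax_ge_id.
have est_bv k : (k <= K)%N -> forall u,
    bias_var_bounded P (fun w => est w k u) (grad f u) bmax smax.
  move=> kK u; apply: bias_var_bounded_le (hest k kK u); first exact: hsigma.
  - exact: (le_bigmax _ (fun k : 'I_K.+1 => b k) (Ordinal (kK : (k < K.+1)%N))).
  - exact: (le_bigmax _ (fun k : 'I_K.+1 => sigma k) (Ordinal (kK : (k < K.+1)%N))).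
have [good rate] := sstm_high_probability hf hxs hsmooth hgrad hconv hK hdelta0
  hdelta1 hL hr bmax0 smax0 ha hx0 horacle hrule hindep est_bv.
split=> [//|aE hK_delta]; apply: rate; rewrite aE.
exact: rate_bound.
Qed.
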